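(* Let $g\ge2$, let $f:\mathcal H_g\to\mathbb C$ be a $\Gamma_g$-invariant (automorphic) function, and let $1\le r\le g-1$. Assume that the iterated unipotent average $$\langle f\rangle_{v_1,\dots,v_r}(\tau_{g-r}):=\int\prod_{i=1}^r dw_{ii}\,d\underline w^{(i)}\,d\underline u^{(i)}\;f(\tau_g)$$ exists, where the integral runs over the $2gr-r^2$ unipotent coordinates $w_{ii},\underline w^{(i)},\underline u^{(i)}$ ($1\le i\le r$), successively for $i=1,\dots,r$, each time modulo the parabolic identifications (see the context). Then $\langle f\rangle_{v_1,\dots,v_r}(\tau_{g-r})$ is a $\Gamma_{g-r}$-invariant function on $\mathbb R_{>0}^r\times\mathcal H_{g-r}$: $$\langle f\rangle_{v_1,\dots,v_r}\big((a\tau_{g-r}+b)(c\tau_{g-r}+d)^{-1}\big)=\langle f\rangle_{v_1,\dots,v_r}(\tau_{g-r})\qquad\text{for all }\begin{pmatrix}a&b\\c&d\end{pmatrix}\in\Gamma_{g-r}.$$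
   Context: $\mathcal H_h$ is the Siegel upper half space of symmetric complex $h\times h$ matrices with positive definite imaginary part. $\Gamma_h=Sp(2h,\mathbb Z)$ acts on it by $\tau\mapsto(a\tau+b)(c\tau+d)^{-1}$. Iwasawa coordinates: every $\tau_g\in\mathcal H_g$ is uniquely $\tau_g=W_g+iU_gV_g^2U_g^t$ with $W_g$ real symmetric with entries $w_{ij}$, $U_g$ real upper unitriangular with entries $u_{ij}$ ($i<j$), and $V_g=\mathrm{diag}(\sqrt{v_1},\dots,\sqrt{v_g})$, $v_i>0$. Put $\underline w^{(i)}=(w_{i,i+1},\dots,w_{i,g})$ and $\underline u^{(i)}=(u_{i,i+1},\dots,u_{i,g})$ (rows). For $0\le i\le g-1$ let $W_{g-i},U_{g-i},V_{g-i}$ be the lower right $(g-i)\times(g-i)$ blocks of $W_g,U_g,V_g$, and put $\tau_{g-i}=W_{g-i}+iU_{g-i}V_{g-i}^2U_{g-i}^t\in\mathcal H_{g-i}$ (where the $i$ multiplying $U_{g-i}$ is $\sqrt{-1}$), which is the lower right block of $\tau_g$. Then for $1\le i\le g-1$ (writing $\sqrt{-1}$ for the imaginary unit) $$\tau_{g-i+1}=\begin{pmatrix}\tau_1&\tau_2\\ \tau_2^t&\tau_{g-i}\end{pmatrix},\quad \tau_1=w_{ii}+\sqrt{-1}\,(v_i+\underline u^{(i)}V_{g-i}^2\underline u^{(i)t}),\quad \tau_2=\underline w^{(i)}+\sqrt{-1}\,\underline u^{(i)}V_{g-i}^2U_{g-i}^t.$$ Iterated average: step $i$ takes the $\Gamma_{g-i+1}$-invariant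 function on $\mathcal H_{g-i+1}$ obtained after $i-1$ steps (with $v_1,\dots,v_{i-1}$ as parameters; it is $f$ itself when $i=1$), and integrates it, for fixed $v_i>0$ and $\tau_{g-i}\in\mathcal H_{g-i}$, with respect to $dw_{ii}\,d\underline w^{(i)}\,d\underline u^{(i)}$ over $\mathbb R^{2(g-i)+1}$ modulo the parabolic identifications. This means over a measurable fundamental domain for the discrete, Lebesgue-measure-preserving action generated by $$(\tau_1,\tau_2)\mapsto(\tau_1+m\tau_{g-i}m^t+2m\tau_2^t+nm^t+q,\ \tau_2+m\tau_{g-i}+n),\quad m,n\in\mathbb Z^{g-i}\text{ (rows)},\ q\in\mathbb Z,$$ and $(\tau_1,\tau_2)\mapsto(\tau_1,-\tau_2)$. These maps fix $v_i$ and $\tau_{g-i}$. They come from the elements of the parabolic subgroup $P_{g-i+1,1}\cap\Gamma_{g-i+1}$ acting trivially on $\tau_{g-i}$. *)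

(* Defs.v *)
From HB Require Import structures.
From mathcomp Require Import all_boot all_order all_algebra.
From mathcomp Require Import complex.
From mathcomp Require Import all_classical all_reals all_analysis.

Set Implicit Arguments.
Unset Strict Implicit.
Unset Printing Implicit Defensive.

Import Order.TTheory GRing.Theory Num.Theory.
Import numFieldNormedType.Exports.

Local Open Scope classical_set_scope.
Local Open Scope ring_scope.
Local Open Scope complex_scope.

Section LebesgueTuple.
Variable R : realType.

(* n-dimensional Lebesgue measure, as the iterated product of the
   one-dimensional one. *)
Fixpoint lebesgue_tuple (n : nat) :
    set (n.-tuple (measurableTypeR R)) -> \bar R :=
  match n with
  | 0 => dirac [tuple]
  | n'.+1 =>
      pushforward (product_measure1 (@lebesgue_measure R) (@lebesgue_tuple n'))
        (fun p : measurableTypeR R * n'.-tuple (measurableTypeR R) =>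
           [the n'.+1.-tuple (measurableTypeR R) of p.1 :: p.2])
  end.
Arguments lebesgue_tuple : clear implicits.

Let cons_fun n (p : measurableTypeR R * n.-tuple (measurableTypeR R)) :=
  [the n.+1.-tuple (measurableTypeR R) of p.1 :: p.2].

Let uncons n (t : n.+1.-tuple (measurableTypeR R)) :
  measurableTypeR R * n.-tuple (measurableTypeR R) :=
  (thead t, [tuple of behead t]).

Let uncons_cons n : cancel (@uncons n) (@cons_fun n).
Proof. by move=> t; rewrite [RHS]tuple_eta. Qed.

Let measurable_cons_fun n : measurable_fun setT (@cons_fun n).
Proof. exact: measurable_cons. Qed.

Let measurable_uncons n : measurable_fun setT (@uncons n).
Proof.
apply/measurable_fun_pairP; split.
  exact: (measurable_tnth ord0).
exact: measurable_behead.
Qed.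

Let cons_uncons n : cancel (@cons_fun n) (@uncons n).
Proof. by case=> x t; rewrite /uncons /cons_fun theadE; congr pair; exact: val_inj. Qed.

Let lebesgue_tuple_spec n :
  [/\ lebesgue_tuple n set0 = 0%E,
      forall A, (0 <= lebesgue_tuple n A)%E,
      semi_sigma_additive (lebesgue_tuple n) &
      sigma_finite setT (lebesgue_tuple n)].
Proof.
elim: n => [|n [m0 mge0 madd mfin]].
  split; [exact: measure0 | by move=> A; exact: measure_ge0 |
    exact: measure_semi_sigma_additive | exact: sigma_finiteT].
pose mM := isMeasure.Build _ _ _ (lebesgue_tuple n) m0 mge0 madd.
pose m1 : {measure set (n.-tuple (measurableTypeR R)) -> \bar R} :=
  HB.pack (lebesgue_tuple n) mM.
pose m : {sigma_finite_measure set (n.-tuple (measurableTypeR R)) -> \bar R} :=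
  HB.pack (lebesgue_tuple n) mM (Measure_isSigmaFinite.Build _ _ _ m1 mfin).
have mE : lebesgue_tuple n = m by [].
have {mE} stepE : lebesgue_tuple n.+1 =
    pushforward ((@lebesgue_measure R) \x m)%E (@cons_fun n).
  by rewrite -mE.
move: m stepE => m ->{m0 mge0 madd mfin mM m1}.
pose pm := measure_function_pushforward__canonical__measure_function_Measure
  ((@lebesgue_measure R) \x m)%E (@measurable_cons_fun n).
split; [exact: (measure0 pm) | by move=> A; exact: (measure_ge0 pm) |
  exact: (@measure_semi_sigma_additive _ _ _ pm) |].
have [F FT Ffin] : sigma_finite setT ((@lebesgue_measure R) \x m)%E.
  (* Canonical inference only finds the instance for finite measures. *)
  exact: lebesgue_integral_fubini.product_measure_sigma_finite_subproof.
exists (fun i => @uncons n @^-1` F i).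
  by rewrite -preimage_bigcup -FT preimage_setT.
move=> i; have [mF Foo] := Ffin i; split.
  by rewrite -[X in measurable X]setTI; exact: measurable_uncons.
rewrite /pushforward (_ : _ @^-1` _ = F i)//.
by apply/seteqP; split => p /=; rewrite cons_uncons.
Qed.

Let lebesgue_tuple0 n : lebesgue_tuple n set0 = 0%E.
Proof. by have [] := lebesgue_tuple_spec n. Qed.

Let lebesgue_tuple_ge0 n A : (0 <= lebesgue_tuple n A)%E.
Proof. by have [_ ge0 _ _] := lebesgue_tuple_spec n; exact: ge0. Qed.

Let lebesgue_tuple_sigma_additive n : semi_sigma_additive (lebesgue_tuple n).
Proof. by have [] := lebesgue_tuple_spec n. Qed.

Let lebesgue_tuple_sigma_finite n : sigma_finite setT (lebesgue_tuple n).
Proof. by have [] := lebesgue_tuple_spec n. Qed.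

HB.instance Definition _ n := isMeasure.Build _ _ _ (lebesgue_tuple n)
  (@lebesgue_tuple0 n) (@lebesgue_tuple_ge0 n)
  (@lebesgue_tuple_sigma_additive n).

HB.instance Definition _ n := Measure_isSigmaFinite.Build _ _ _
  (lebesgue_tuple n) (@lebesgue_tuple_sigma_finite n).

End LebesgueTuple.
Arguments lebesgue_tuple {R} n.

Section Siegel.
Variable R : realType.
Local Notation C := R[i].

Definition posdef h (Y : 'M[R]_h) :=
  Y^T = Y /\ forall x : 'cV[R]_h, x != 0 -> 0 < (x^T *m Y *m x) 0 0.

Definition Siegel h : set 'M[C]_h :=
  [set tau | tau^T = tau /\ posdef (map_mx (@complex.Im R) tau)].

Definition symplectic_form h : 'M[int]_(h + h) :=
  block_mx 0 1%:M (- 1%:M) 0.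

Definition Gamma h : set 'M[int]_(h + h) :=
  [set M | M^T *m symplectic_form h *m M = symplectic_form h].

Definition intC (z : int) : C := z%:~R.

Definition Siegel_act h (M : 'M[int]_(h + h)) (tau : 'M[C]_h) : 'M[C]_h :=
  let N := map_mx intC M in
  (ulsubmx N *m tau + ursubmx N) *m invmx (dlsubmx N *m tau + drsubmx N).

(* Only the values of f on the Siegel upper half space matter. *)
Definition Gamma_invariant h (f : 'M[C]_h -> C) :=
  forall M (tau : 'M[C]_h), Gamma M -> Siegel tau -> f (Siegel_act M tau) = f tau.

Definition complex_mx m n (A B : 'M[R]_(m, n)) : 'M[C]_(m, n) :=
  map2_mx (fun a b => a +i* b) A B.

Definition unitriangular h (U : 'M[R]_h) :=
  forall i j : 'I_h, (j <= i)%N -> U i j = (i == j)%:R.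

Definition sqrt_diag h (v : 'rV[R]_h) : 'M[R]_h := diag_mx (map_mx Num.sqrt v).

Definition is_Iwasawa h (tau : 'M[C]_h) (c : 'M[R]_h * 'M[R]_h * 'rV[R]_h) :=
  let: (W, U, v) := c in
  [/\ W^T = W, unitriangular U, forall i, 0 < v 0 i &
      tau = complex_mx W (U *m sqrt_diag v ^+ 2 *m U^T)].

(* The coordinates (W, U, (v_1, ..., v_h)) of tau; every point of the Siegel
   upper half space has exactly one such triple. *)
Definition Iwasawa h (tau : 'M[C]_h) : 'M[R]_h * 'M[R]_h * 'rV[R]_h :=
  xget (0, 0, 0) [set c | is_Iwasawa tau c].

(* The unipotent coordinates ((w_ii, w^(i)), u^(i)) in R^(2k+1), k = g - i. *)
Definition unip k : Type :=
  measurableTypeR R * k.-tuple (measurableTypeR R) *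
  k.-tuple (measurableTypeR R).

HB.instance Definition _ k := Measurable.on (unip k).

Definition unip_measure k : set (unip k) -> \bar R :=
  product_measure1
    (product_measure1 (@lebesgue_measure R) (lebesgue_tuple k))
    (lebesgue_tuple k).

HB.instance Definition _ k := Measure.on (@unip_measure k).

Definition row_of_tuple k (t : k.-tuple R) : 'rV[R]_k := \row_j tnth t j.

(* The first row (tau_1, tau_2) of tau_{g-i+1}, as a function of v = v_i,
   tau = tau_{g-i} and the unipotent coordinates. *)
Definition border k (v : R) (tau : 'M[C]_k) (x : unip k) : C * 'rV[C]_k :=
  let: (_, U, vs) := Iwasawa tau in
  let: (wii, w, u) := x in
  let w' := row_of_tuple w in
  let u' := row_of_tuple u in
  let V2 := sqrt_diag vs ^+ 2 in
  (wii +i* (v + (u' *m V2 *m u'^T) 0 0), complex_mx w' (u' *m V2 *m U^T)).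

Definition bordered k (t : C * 'rV[C]_k) (tau : 'M[C]_k) : 'M[C]_k.+1 :=
  block_mx (t.1%:M : 'M[C]_1) t.2 t.2^T tau.

Definition heisenberg_act k (tau : 'M[C]_k) (m n : 'rV[int]_k) (q : int)
    (t : C * 'rV[C]_k) : C * 'rV[C]_k :=
  let m' := map_mx intC m in
  let n' := map_mx intC n in
  (t.1 + (m' *m tau *m m'^T) 0 0 + 2%:R * (m' *m t.2^T) 0 0
     + (n' *m m'^T) 0 0 + intC q,
   t.2 + m' *m tau + n').

(* The group of parabolic identifications.  Closing under inverses is not
   needed, since the inverses of both kinds of generators are generators. *)
Inductive parabolic k (tau : 'M[C]_k) : (C * 'rV[C]_k -> C * 'rV[C]_k) -> Prop :=
| parabolic_id : parabolic tau id
| parabolic_heisenberg m n q : parabolic tau (heisenberg_act tau m n q)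
| parabolic_sign : parabolic tau (fun t => (t.1, - t.2))
| parabolic_comp p1 p2 :
    parabolic tau p1 -> parabolic tau p2 -> parabolic tau (p1 \o p2).

(* D is measurable, it meets almost every orbit, and D and its translate by a
   group element acting nontrivially overlap in a null set. *)
Definition fundamental_domain k (v : R) (tau : 'M[C]_k) (D : set (unip k)) :=
  [/\ measurable D,
      {ae @unip_measure k, forall x, exists p, parabolic tau p /\
         exists2 y, D y & border v tau y = p (border v tau x)} &
      forall p, parabolic tau p -> (exists t, p t <> t) ->
        (@unip_measure k).-negligible
          [set x | D x /\ exists2 y, D y & border v tau y = p (border v tau x)]].

Section Average.
(* A choice of fundamental domains: D v_i tau_{g-i}. *)
Variable D : forall k, R -> 'M[C]_k -> set (unip k).

Definition average_exists k (F : 'M[C]_k.+1 -> C) (v : R) (tau : 'M[C]_k) :=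
  let G x := F (bordered (border v tau x) tau) in
  (@unip_measure k).-integrable (D v tau) (EFin \o (@complex.Re R \o G)) /\
  (@unip_measure k).-integrable (D v tau) (EFin \o (@complex.Im R \o G)).

Definition average k (F : 'M[C]_k.+1 -> C) (v : R) (tau : 'M[C]_k) : C :=
  let G x := F (bordered (border v tau x) tau) in
  Rintegral (@unip_measure k) (D v tau) (@complex.Re R \o G) +i*
  Rintegral (@unip_measure k) (D v tau) (@complex.Im R \o G).

(* <f>_{v_1, ..., v_r}, where v lists v_1, ..., v_r.  The branch g = 0 < r is
   a dummy value. *)
Fixpoint iter_average (r g : nat) {struct r} :
    ('M[C]_g -> C) -> r.-tuple R -> 'M[C]_(g - r) -> C :=
  match r, g return ('M[C]_g -> C) -> r.-tuple R -> 'M[C]_(g - r) -> C with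
  | 0, 0 => fun f _ => f
  | 0, g'.+1 => fun f _ => f
  | r'.+1, 0 => fun f _ => f
  | r'.+1, g'.+1 => fun f v =>
      @iter_average r' g' (average f (thead v)) [tuple of behead v]
  end.

(* Each of the r successive integrals converges absolutely, at every point of
   the Siegel upper half space on which it is a function. *)
Fixpoint iter_average_exists (r g : nat) {struct r} :
    ('M[C]_g -> C) -> r.-tuple R -> Prop :=
  match r, g return ('M[C]_g -> C) -> r.-tuple R -> Prop with
  | r'.+1, g'.+1 => fun f v =>
      (forall tau : 'M[C]_g', Siegel tau -> average_exists f (thead v) tau) /\
      @iter_average_exists r' g' (average f (thead v)) [tuple of behead v]
  | _, _ => fun _ _ => True
  end.

End Average.

End Siegel.

(* Main.v *)
(** Write tau_1 = kap + i v + la tau_2^T and tau_2 = la tau + mu with kap real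
    and la, mu real rows.  In the coordinates (kap, la, mu) the parabolic
    identifications are the sign change and the translations of an integral
    Heisenberg group, independently of tau, while an element M of Gamma_k, seen
    in Gamma_(k+1), acts by fixing kap and by (la, mu) |-> (la, mu) M^-1.  The
    passage to the coordinates (w_ii, w, u) is affine up to a shear in kap, with
    determinant +-1, hence preserves Lebesgue measure; so does M, and M
    normalizes the Heisenberg group.  Thus, read in (kap, la, mu), the fundamental
    domains chosen at tau and at M tau become two fundamental domains of the same
    group for the same invariant integrand, and two such integrals agree. *)
From HB Require Import structures.
Require Import Defs.
From mathcomp Require Import all_boot all_order all_algebra.
From mathcomp Require Import complex.
From mathcomp Require Import all_classical all_reals all_analysis.
From mathcomp Require Import measurable_realfun ring lra.

Set Implicit Arguments.
Unset Strict Implicit.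
Unset Printing Implicit Defensive.

Import Order.TTheory GRing.Theory Num.Theory.
Import numFieldNormedType.Exports.

Local Open Scope classical_set_scope.
Local Open Scope ring_scope.
Local Open Scope complex_scope.

(** * Maps scaling a measure *)

Section ScalesMeasure.
Context (R : realType).

(** The domains [D] chosen at tau and at M tau are unrelated, so invariance has two sources: the
    integral of an invariant function over a fundamental domain does not depend on the domain, and M
    carries one setting to the other. Neither is visible in the coordinates (w_ii, w, u), where the
    group and the action of M vary with tau. Removing la tau_2^T from tau_1 cures this: translation
    by an integral row (m, n) changes kap by an integer plus m mu^T - la n^T, the value of the
    standard symplectic form [omega] at (m, n) and (la, mu). As M^-1 preserves [omega] and
    integrality, it normalizes the group.

    Domains are fundamental only up to null sets, and the integrand is known to be measurable only
    on them. Two domains are therefore compared by enumerating the countable group, discarding one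
    null set, and moving disjoint pieces of one domain into the other.

    Lebesgue measure on tuples is an iterated product, so changes of variables come from
    one-dimensional affine maps by Tonelli and a factorization of matrices; some factors have
    Jacobian other than 1, whence the constant in [scales_measure]. *)

Definition scales_measure d1 d2 (T1 : measurableType d1) (T2 : measurableType d2)
    (c : R) (mu : set T1 -> \bar R) (nu : set T2 -> \bar R) (phi : T1 -> T2) :=
  measurable_fun setT phi /\
  forall A, measurable A -> mu (phi @^-1` A) = (c%:E * nu A)%E.

Lemma scales_measurable d1 d2 (T1 : measurableType d1) (T2 : measurableType d2)
    (c : R) (mu : set T1 -> \bar R) (nu : set T2 -> \bar R) (phi : T1 -> T2) A :
  scales_measure c mu nu phi -> measurable A -> measurable (phi @^-1` A).
Proof. by move=> [mphi _] mA; rewrite -[X in measurable X]setTI; exact: mphi. Qed.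

Context d1 d2 d3 (T1 : measurableType d1) (T2 : measurableType d2)
  (T3 : measurableType d3).

Lemma scales_comp c c' mu nu la (phi : T1 -> T2) (psi : T2 -> T3) :
  scales_measure c mu nu phi -> scales_measure c' nu la psi ->
  scales_measure (c * c') mu la (psi \o phi).
Proof.
move=> sphi spsi; have [mphi phiE] := sphi; have [mpsi psiE] := spsi.
split=> [|A mA]; first exact: measurableT_comp.
rewrite comp_preimage phiE; last exact: (scales_measurable spsi).
by rewrite psiE// EFinM muleA.
Qed.

Lemma scales_id (mu : set T1 -> \bar R) : scales_measure 1 mu mu id.
Proof. by split=> // A mA; rewrite mul1e. Qed.

Lemma scales_pushforward (mu : set T1 -> \bar R) (phi : T1 -> T2) :
  measurable_fun setT phi -> scales_measure 1 mu (pushforward mu phi) phi.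
Proof. by move=> mphi; split=> // A mA; rewrite mul1e. Qed.

Lemma ge0_integral_scales (mu : {measure set T1 -> \bar R})
    (nu : {measure set T2 -> \bar R}) (phi : T1 -> T2) D (f : T2 -> \bar R) :
  scales_measure 1 mu nu phi -> measurable D -> measurable_fun D f ->
  (forall y, D y -> 0 <= f y)%E ->
  (\int[mu]_(x in phi @^-1` D) (f \o phi) x = \int[nu]_(y in D) f y)%E.
Proof.
move=> [mphi phiE] mD mf f0; rewrite -ge0_integral_pushforward//; last first.
  by move=> y; rewrite inE; exact: f0.
apply: eq_measure_integral => A mA _; by rewrite -[RHS]mul1e -phiE.
Qed.

Lemma integral_scales (mu : {measure set T1 -> \bar R})
    (nu : {measure set T2 -> \bar R}) (phi : T1 -> T2) D (f : T2 -> \bar R) :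
  scales_measure 1 mu nu phi -> measurable D -> measurable_fun D f ->
  (\int[mu]_(x in phi @^-1` D) (f \o phi) x = \int[nu]_(y in D) f y)%E.
Proof.
move=> sphi mD mf; rewrite integralE [RHS]integralE; congr (_ - _)%E.
- rewrite -(ge0_integral_scales sphi)//; last exact: measurable_funepos.
  by congr integral; apply/funext => x; rewrite unlock.
- rewrite -(ge0_integral_scales sphi)//; last exact: measurable_funeneg.
  by congr integral; apply/funext => x; rewrite unlock.
Qed.

Lemma negligible_scales (mu : set T1 -> \bar R)
    (nu : set T2 -> \bar R) c (phi : T1 -> T2) A :
  scales_measure c mu nu phi -> nu.-negligible A ->
  mu.-negligible (phi @^-1` A).
Proof.
move=> sphi [B [mB B0 AB]]; exists (phi @^-1` B); split.
- exact: (scales_measurable sphi).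
- by rewrite (sphi.2 _ mB) B0 mule0.
- exact: preimage_subset.
Qed.

End ScalesMeasure.

Lemma product_measure12 (R : realType) d1 d2 (T1 : measurableType d1)
    (T2 : measurableType d2) (m1 : {sigma_finite_measure set T1 -> \bar R})
   (m2 : {sigma_finite_measure set T2 -> \bar R}) A : measurable A ->
  (m1 \x m2)%E A = (m1 \x^ m2)%E A.
Proof.
by move=> mA; apply: product_measure_unique => //= *; rewrite product_measure2E.
Qed.

(** * Skew products and reassociation of product measures *)

Section Products.
Context (R : realType) d1 d2 d3 (T1 : measurableType d1) (T2 : measurableType d2)
  (T3 : measurableType d3).
Local Open Scope ereal_scope.

(** The section at x of a preimage is the preimage under [psi x] of the section at x, so the
    fibrewise constant [c] factors out of the outer integral. *)
Lemma scales_skew_snd c (m1 : {measure set T1 -> \bar R})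
   (m2 : {sigma_finite_measure set T2 -> \bar R})
   (n2 : {sigma_finite_measure set T3 -> \bar R}) (psi : T1 -> T2 -> T3) :
  (0 <= c)%R ->
  measurable_fun setT (fun p : T1 * T2 => psi p.1 p.2) ->
  (forall x, scales_measure c m2 n2 (psi x)) ->
  scales_measure c (m1 \x m2) (m1 \x n2) (fun p => (p.1, psi p.1 p.2)).
Proof.
move=> c0 mpsi spsi; split; first exact: measurable_fun_pair.
move=> A mA; rewrite /product_measure1 -ge0_integralZl//; last first.
  exact: measurable_fun_xsection.
apply: eq_integral => x _ /=; rewrite -(spsi x).2; last exact: measurable_xsection.
by congr (m2 _); apply/seteqP; split=> y /=; rewrite /xsection/= !inE.
Qed.

(** Here the inner integral must run over the first factor, hence the passage through
    [product_measure12] to the product measure integrated in the other order. *)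
Lemma scales_skew_fst c (m1 : {sigma_finite_measure set T1 -> \bar R})
   (n1 : {sigma_finite_measure set T3 -> \bar R})
   (m2 : {sigma_finite_measure set T2 -> \bar R}) (psi : T2 -> T1 -> T3) :
  (0 <= c)%R ->
  measurable_fun setT (fun p : T1 * T2 => psi p.2 p.1) ->
  (forall y, scales_measure c m1 n1 (psi y)) ->
  scales_measure c (m1 \x m2) (n1 \x m2) (fun p => (psi p.2 p.1, p.2)).
Proof.
move=> c0 mpsi spsi; have mphi : measurable_fun setT
  (fun p : T1 * T2 => (psi p.2 p.1, p.2)) by exact: measurable_fun_pair.
split=> // A mA; rewrite product_measure12; last first.
  by rewrite -[X in measurable X]setTI; exact: mphi.
rewrite product_measure12// /product_measure2 -ge0_integralZl//; last first.
  exact: measurable_fun_ysection.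
apply: eq_integral => y _ /=; rewrite -(spsi y).2; last exact: measurable_ysection.
by congr (m1 _); apply/seteqP; split=> x /=; rewrite /ysection/= !inE.
Qed.

Lemma scales_assoc (m1 : {sigma_finite_measure set T1 -> \bar R})
   (m2 : {sigma_finite_measure set T2 -> \bar R})
   (m3 : {sigma_finite_measure set T3 -> \bar R}) :
  scales_measure 1 ((m1 \x m2) \x m3) (m1 \x (m2 \x m3))
    (fun p => (p.1.1, (p.1.2, p.2))).
Proof.
have mphi : measurable_fun setT (fun p : T1 * T2 * T3 => (p.1.1, (p.1.2, p.2))).
  apply: measurable_fun_pair; first exact: measurableT_comp.
  by apply: measurable_fun_pair => //; exact: measurableT_comp.
split=> // A mA; rewrite mul1e.
have mpA : measurable ((fun p : T1 * T2 * T3 => (p.1.1, (p.1.2, p.2))) @^-1` A).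
  by rewrite -[X in measurable X]setTI; exact: mphi.
rewrite [LHS]/product_measure1 fubini_tonelli1;
  [|exact: measurable_fun_xsection|by move=> ?; exact: measure_ge0].
apply: eq_integral => x _ /=.
rewrite /fubini_F/=; apply: eq_integral => y _ /=.
by congr (m3 _); apply/seteqP; split=> z; rewrite /xsection/= !inE /preimage/= inE.
Qed.

Lemma scales_assoc' (m1 : {sigma_finite_measure set T1 -> \bar R})
   (m2 : {sigma_finite_measure set T2 -> \bar R})
   (m3 : {sigma_finite_measure set T3 -> \bar R}) :
  scales_measure 1 (m1 \x (m2 \x m3)) ((m1 \x m2) \x m3)
    (fun p => ((p.1, p.2.1), p.2.2)).
Proof.
have mphi : measurable_fun setT (fun p : T1 * (T2 * T3) => ((p.1, p.2.1), p.2.2)).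
  apply: measurable_fun_pair; last exact: measurableT_comp.
  by apply: measurable_fun_pair => //; exact: measurableT_comp.
split=> // A mA; rewrite mul1e.
have mpA : measurable ((fun p : T1 * (T2 * T3) => ((p.1, p.2.1), p.2.2)) @^-1` A).
  by rewrite -[X in measurable X]setTI; exact: mphi.
rewrite -[LHS]mul1e -(scales_assoc m1 m2 m3).2//.
by congr (product_measure1 _ _ _); apply/seteqP; split=> -[[x y] z].
Qed.

End Products.

(** * Affine maps and Lebesgue measure on tuples *)

Lemma scales_lebesgue_affine (R : realType) (a c : R) : a != 0 ->
  scales_measure `|a|^-1 (@lebesgue_measure R) (@lebesgue_measure R)
    (fun x : measurableTypeR R => a * x + c : measurableTypeR R).
Proof.
move=> a0; have mphi : measurable_fun setT
    (fun x : measurableTypeR R => a * x + c : measurableTypeR R).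
  by apply: measurable_funD => //; exact: measurable_funM.
split=> // A mA.
pose k : {nonneg R} := NngNum (normr_ge0 a).
pose pm := measure_function_pushforward__canonical__measure_function_Measure
  (@lebesgue_measure R) mphi.
have -> : lebesgue_measure A = mscale k pm A.
  apply: lebesgue_measure_unique => // _ [[x y] _ <-] /=.
  rewrite /mscale/= /pushforward/=.
  (* A negative [a] reverses the interval and so exchanges its open and closed endpoints. *)
  have -> : (fun z : R => a * z + c) @^-1` `]x, y]%classic =
      [set` if 0 < a then `](x - c) / a, (y - c) / a]
            else `[(y - c) / a, (x - c) / a[].
    have [a_gt0|a_le0] := ltP 0 a.
      apply/seteqP; split=> z /=; rewrite !in_itv/= ltr_pdivrMr// ler_pdivlMr//;
        by rewrite [z * a]mulrC ltrBlDr lerBrDr.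
    have a_lt0 : a < 0 by rewrite lt_neqAle a0.
    by apply/seteqP; split=> z /=;
      rewrite !in_itv/= ler_ndivrMr// ltr_ndivlMr// [z * a]mulrC ltrBlDr lerBrDr andbC.
  rewrite [LHS]lebesgue_measure_itv/=.
  have -> : lebesgue_measure
      [set` if 0 < a then `](x - c) / a, (y - c) / a]
            else `[(y - c) / a, (x - c) / a[] =
      (if (x < y)%R then (`|a|^-1 * (y - x))%:E else 0)%E.
    case: ifPn => [a_gt0|].
      rewrite lebesgue_measure_itv/= !lte_fin ltr_pM2r ?invr_gt0// ltrD2r.
      case: ifP => // _; rewrite -EFinD gtr0_norm//; congr EFin; ring.
    rewrite -leNgt le_eqVlt (negbTE a0)/= => a_lt0.
    rewrite lebesgue_measure_itv/= !lte_fin ltr_nM2r ?invr_lt0// ltrD2r.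
    case: ifP => // _; rewrite -EFinD ltr0_norm// invrN; congr EFin; ring.
  rewrite lte_fin; case: ifP => // _; last by rewrite mule0.
  by rewrite -EFinM mulrA divff ?normr_eq0// mul1r.
by rewrite /mscale/= /pushforward muleA -EFinM mulVf ?normr_eq0// mul1e.
Qed.

Section Rows.
Context (R : realType).

Definition tuple_of_row n (x : 'rV[R]_n) : n.-tuple (measurableTypeR R) :=
  [tuple x 0 j | j < n].

Lemma tuple_of_rowK n : cancel (@tuple_of_row n) (@row_of_tuple R n).
Proof. by move=> x; apply/rowP => j; rewrite mxE tnth_mktuple. Qed.

Lemma row_of_tupleK n : cancel (@row_of_tuple R n) (@tuple_of_row n).
Proof. by move=> t; apply: eq_from_tnth => j; rewrite tnth_mktuple mxE. Qed.

Definition measurable_row d (T : measurableType d) n (f : T -> 'rV[R]_n) :=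
  forall j, measurable_fun setT (fun x => f x 0 j).

Section Closure.
Context d (T : measurableType d).

Lemma measurable_row_of_tuple n (f : T -> n.-tuple (measurableTypeR R)) :
  measurable_fun setT f -> measurable_row (fun x => row_of_tuple (f x)).
Proof.
move=> /measurable_fun_tnthP mf j.
by apply: (eq_measurable_fun _ _ (mf j)) => x _; rewrite mxE.
Qed.

Lemma measurable_tuple_of_row n (f : T -> 'rV[R]_n) :
  measurable_row f -> measurable_fun setT (fun x => tuple_of_row (f x)).
Proof.
move=> mf; apply/measurable_fun_tnthP => j.
by apply: (eq_measurable_fun _ _ (mf j)) => x _; rewrite /= tnth_mktuple.
Qed.

Lemma measurable_rowD n (f g : T -> 'rV[R]_n) :
  measurable_row f -> measurable_row g -> measurable_row (fun x => f x + g x).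
Proof.
move=> mf mg j.
by apply: (eq_measurable_fun _ _ (measurable_funD (mf j) (mg j))) => x _;
  rewrite mxE.
Qed.

Lemma measurable_row_cst n (c : 'rV[R]_n) : measurable_row (fun _ : T => c).
Proof. by move=> j. Qed.

Lemma measurable_rowZ n (f : T -> R) (g : T -> 'rV[R]_n) :
  measurable_fun setT f -> measurable_row g ->
  measurable_row (fun x => f x *: g x).
Proof.
move=> mf mg j.
by apply: (eq_measurable_fun _ _ (measurable_funM mf (mg j))) => x _;
  rewrite mxE.
Qed.

Lemma measurable_rowM m n (f : T -> 'rV[R]_m) (g : T -> 'M[R]_(m, n)) :
  measurable_row f -> (forall i, measurable_row (fun x => row i (g x))) ->
  measurable_row (fun x => f x *m g x).
Proof.
move=> mf mg j.
have ms : measurable_fun setT (fun x => \sum_i f x 0 i * g x i j).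
  apply: measurable_sum => i; apply: measurable_funM => //.
  by apply: (eq_measurable_fun _ _ (mg i j)) => x _; rewrite mxE.
by apply: (eq_measurable_fun _ _ ms) => x _; rewrite mxE.
Qed.

End Closure.

Definition affine_tuple n (A : 'M[R]_n) (c : 'rV[R]_n)
    (t : n.-tuple (measurableTypeR R)) :=
  tuple_of_row (row_of_tuple t *m A + c).

Definition tuple_cons n (p : measurableTypeR R * n.-tuple (measurableTypeR R)) :=
  [the n.+1.-tuple (measurableTypeR R) of p.1 :: p.2].

Definition tuple_uncons n (t : n.+1.-tuple (measurableTypeR R)) :
    measurableTypeR R * n.-tuple (measurableTypeR R) :=
  (thead t, [tuple of behead t]).

Arguments tuple_cons : simpl never.
Arguments tuple_uncons : simpl never.

Lemma tuple_unconsK n : cancel (@tuple_uncons n) (@tuple_cons n).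
Proof. by move=> t; rewrite [RHS]tuple_eta. Qed.

Lemma tuple_consK n : cancel (@tuple_cons n) (@tuple_uncons n).
Proof.
by case=> x t; rewrite /tuple_uncons /tuple_cons theadE; congr pair; exact: val_inj.
Qed.

Lemma row_tuple_cons n x (t : n.-tuple (measurableTypeR R)) :
  row_of_tuple (tuple_cons (x, t)) =
  row_mx (x%:M : 'M[R]_1) (row_of_tuple t) :> 'rV_(1 + n).
Proof.
apply/rowP => j; rewrite !mxE; case: splitP => i ji.
  by rewrite mxE ord1 mulr1n (_ : j = ord0)//; apply: val_inj; rewrite /= ji ord1.
rewrite mxE (_ : j = lift ord0 i); last by apply: val_inj.
by rewrite tnthS; congr tnth; exact: val_inj.
Qed.

Lemma scales_tuple_cons n :
  scales_measure 1 (product_measure1 lebesgue_measure (lebesgue_tuple n))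
    (lebesgue_tuple n.+1) (@tuple_cons n).
Proof. exact/scales_pushforward/measurable_cons. Qed.

Lemma scales_tuple_uncons n :
  scales_measure 1 (lebesgue_tuple n.+1)
    (product_measure1 lebesgue_measure (lebesgue_tuple n)) (@tuple_uncons n).
Proof.
split=> [|A mA].
  apply/measurable_fun_pairP; split; first exact: (measurable_tnth ord0).
  exact: measurable_behead.
rewrite mul1e; congr (product_measure1 _ _ _).
by apply/seteqP; split=> p; rewrite /preimage/= tuple_consK.
Qed.

Lemma measurable_affine_tuple d (T : measurableType d) n (A : 'M[R]_n)
    (c : T -> 'rV[R]_n) (f : T -> n.-tuple (measurableTypeR R)) :
  measurable_fun setT f -> measurable_row c ->
  measurable_fun setT (fun x => affine_tuple A (c x) (f x)).
Proof.
move=> mf mc; apply: measurable_tuple_of_row; apply: measurable_rowD => //.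
apply: measurable_rowM; first exact: measurable_row_of_tuple.
by move=> i; exact: measurable_row_cst.
Qed.

End Rows.
Arguments tuple_cons : simpl never.
Arguments tuple_uncons : simpl never.

(* No permutation is needed, unlike in an LU decomposition: the first factor
   adds a combination of the lower rows to the first one, which makes the corner
   entry nonzero. *)
Lemma block_ul1_decomp (F : fieldType) n (A : 'M[F]_(1 + n)) : \det A != 0 ->
  exists (b0 : 'rV[F]_n) (c0 : 'cV[F]_n) (a : F) (b : 'rV[F]_n) (S : 'M[F]_n),
    [/\ a != 0, \det A = a * \det S &
        A = block_mx (1%:M : 'M[F]_1) b0 0 1%:M *m
            (block_mx 1%:M 0 c0 1%:M *m block_mx (a%:M : 'M[F]_1) b 0 S)].
Proof.
move=> dA.
have [b0 a0] : exists b0 : 'rV[F]_n, (ulsubmx A - b0 *m dlsubmx A) 0 0 != 0.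
  have [A0|A0] := eqVneq (ulsubmx A 0 0) 0; last first.
    by exists 0; rewrite mul0mx subr0.
  have [k Ak] : exists k, dlsubmx A k 0 != 0.
    apply/existsP; apply: contraNT dA; rewrite negb_exists => /forallP Ak.
    rewrite -[A]submxK (_ : ulsubmx A = 0); last first.
      by apply/matrixP => i j; rewrite !ord1 A0 mxE.
    rewrite (_ : dlsubmx A = 0); last first.
      by apply/matrixP => i j; rewrite ord1 [RHS]mxE; apply/eqP/negPn.
    by rewrite det_ublock det_mx11 mxE mul0r.
  by exists (- delta_mx 0 k); rewrite mulNmx opprK mxE A0 add0r -rowE mxE.
pose a := (ulsubmx A - b0 *m dlsubmx A) 0 0.
pose c0 := a^-1 *: dlsubmx A; pose b := ursubmx A - b0 *m drsubmx A.
exists b0, c0, a, b, (drsubmx A - c0 *m b).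
have aE : a%:M = ulsubmx A - b0 *m dlsubmx A.
  by rewrite [RHS]mx11_scalar.
have AE : A = block_mx (1%:M : 'M[F]_1) b0 0 1%:M *m
    (block_mx 1%:M 0 c0 1%:M *m
     block_mx (a%:M : 'M[F]_1) b 0 (drsubmx A - c0 *m b)).
  rewrite !mulmx_block !mul0mx !mulmx0 !mul1mx !addr0 !add0r.
  have -> : c0 *m a%:M = dlsubmx A.
    by rewrite mul_mx_scalar scalerA divff// scale1r.
  rewrite [c0 *m b + _]addrC subrK aE !subrK.
  by rewrite submxK.
split=> //; rewrite {1}AE !det_mulmx det_ublock det_lblock det_ublock.
by rewrite !det1 !mul1r det_mx11 mxE mulr1n.
Qed.

(** A row (x, t) passes through the three factors in turn: t is sheared by x, then x by t, then t
    undergoes S and a shear by x while x is dilated by a. The right-hand side has the shape of the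
    maps [g1] to [g4] composed in [scales_affine_tuple]. *)
Lemma row_block_decomp (F : fieldType) n (x a : F) (b0 b t : 'rV[F]_n)
    (c0 : 'cV[F]_n) (S : 'M[F]_n) (c : 'rV[F]_(1 + n)) (y := t *m 1%:M + x *: b0) :
  row_mx (x%:M : 'M[F]_1) t *m (block_mx (1%:M : 'M[F]_1) b0 0 1%:M *m
      (block_mx 1%:M 0 c0 1%:M *m block_mx (a%:M : 'M[F]_1) b 0 S)) +
    row_mx (lsubmx c) (rsubmx c) =
  row_mx ((a * (1 * x + (y *m c0) 0 0) + c 0 0)%:M : 'M[F]_1)
    (y *m S + ((1 * x + (y *m c0) 0 0) *: b + rsubmx c)).
Proof.
rewrite !mulmxA !mul_row_block !mulmx0 !mulmx1 !addr0 !mul_scalar_mx.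
rewrite [x *: b0 + t]addrC add_row_mx /y mulmx1 mul1r; set u := t + _.
have -> : x%:M + u *m c0 = (x + (u *m c0) 0 0)%:M.
  by rewrite raddfD/= -mx11_scalar.
rewrite add0r !mul_scalar_mx addrA [u *m S + _]addrC; congr row_mx.
rewrite scale_scalar_mx mulrC [lsubmx c]mx11_scalar -raddfD/=.
congr (scalar_mx (_ + _)).
by rewrite mxE; congr (c _ _); exact: val_inj.
Qed.

Section Affine.
Context (R : realType).

(** Induction on n along the factorization of [block_ul1_decomp]. Each of [g1] to [g4] changes only
    the head or only the tail of the tuple, affinely once the other is fixed, so it is a skew
    product. The two shears contribute 1, the others [|\det S|^-1] and [|a|^-1]. *)
Theorem scales_affine_tuple n (A : 'M[R]_n) (c : 'rV[R]_n) : \det A != 0 ->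
  scales_measure `|\det A|^-1 (lebesgue_tuple n) (lebesgue_tuple n)
    (affine_tuple A c).
Proof.
elim: n A c => [|n IHn] A c dA.
  have -> : affine_tuple A c = id.
    by apply/funext => t; rewrite [t]tuple0; exact: tuple0.
  by rewrite det_mx00 normr1 invr1; exact: scales_id.
have [b0 [c0 [a [b [S [a0 dAE AE]]]]]] := @block_ul1_decomp R n A dA.
have dS : \det S != 0 by move: dA; rewrite dAE mulf_eq0 negb_or => /andP[].
pose T := (measurableTypeR R * n.-tuple (measurableTypeR R))%type.
pose leb := @lebesgue_measure R.
pose m := product_measure1 leb (@lebesgue_tuple R n).
pose g1 (p : T) : T := (p.1, affine_tuple 1%:M (p.1 *: b0) p.2).
pose g2 (p : T) : T := (1 * p.1 + (row_of_tuple p.2 *m c0) 0 0, p.2).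
(* The shear by [b] uses the head before its dilation by [a], so [g3] precedes [g4]. *)
pose g3 (p : T) : T := (p.1, affine_tuple S (p.1 *: b + rsubmx (c : 'rV_(1 + n))) p.2).
pose g4 (p : T) : T := (a * p.1 + c 0 0, p.2).
have s1 : scales_measure 1 m m g1.
  apply: (@scales_skew_snd R _ _ _ _ _ _ 1 leb (@lebesgue_tuple R n)
    (@lebesgue_tuple R n) (fun x t => affine_tuple 1%:M (x *: b0) t)) => //.
    apply: measurable_affine_tuple; first exact: measurable_snd.
    by apply: measurable_rowZ; [exact: measurable_fst|exact: measurable_row_cst].
  move=> x; have := IHn 1%:M (x *: b0).
  by rewrite det1 normr1 invr1; apply; exact: oner_neq0.
have s2 : scales_measure 1 m m g2.
  apply: (@scales_skew_fst R _ _ _ _ _ _ 1 leb leb (@lebesgue_tuple R n)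
    (fun t x => 1 * x + (row_of_tuple t *m c0) 0 0)) => //.
    apply: measurable_funD; first exact: measurable_funM.
    apply: (@measurable_rowM R _ _ _ _ _ (fun _ => c0)).
      exact: measurable_row_of_tuple.
    by move=> i; exact: measurable_row_cst.
  move=> t; have := @scales_lebesgue_affine R 1 ((row_of_tuple t *m c0) 0 0).
  by rewrite normr1 invr1; apply; exact: oner_neq0.
have s3 : scales_measure `|\det S|^-1 m m g3.
  apply: (@scales_skew_snd R _ _ _ _ _ _ _ leb (@lebesgue_tuple R n)
    (@lebesgue_tuple R n)
    (fun x t => affine_tuple S (x *: b + rsubmx (c : 'rV_(1 + n))) t)) => //.
    apply: measurable_affine_tuple; first exact: measurable_snd.
    apply: measurable_rowD; last exact: measurable_row_cst.
    by apply: measurable_rowZ; [exact: measurable_fst|exact: measurable_row_cst].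
  by move=> x; exact: IHn.
have s4 : scales_measure `|a|^-1 m m g4.
  apply: (@scales_skew_fst R _ _ _ _ _ _ _ leb leb (@lebesgue_tuple R n)
    (fun t x => a * x + c 0 0)) => //.
    by apply: measurable_funD => //; exact: measurable_funM.
  by move=> t; exact: scales_lebesgue_affine.
have := scales_comp (scales_comp (scales_comp (scales_comp (scales_comp
  (scales_tuple_uncons R n) s1) s2) s3) s4) (scales_tuple_cons R n).
rewrite !mul1r mulr1 -invfM -normrM mulrC -dAE.
congr scales_measure; apply/funext => t /=.
rewrite -[RHS]row_of_tupleK -[LHS]row_of_tupleK; congr tuple_of_row.
rewrite tuple_of_rowK -[t in RHS]tuple_unconsK.
case: (tuple_uncons t) => x {}t.
rewrite !row_tuple_cons /g4 /g3 /g2 /g1/= !tuple_of_rowK.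
rewrite -[c in RHS](@hsubmxK _ 1 1 n) [in RHS]AE.
exact/esym/row_block_decomp.
Qed.

End Affine.

Lemma scales_map_fst (R : realType) d1 d2 d3 (T1 : measurableType d1)
    (T2 : measurableType d2) (T3 : measurableType d3)
    (m1 : {measure set T1 -> \bar R}) (n1 : {measure set T3 -> \bar R})
    (m2 : {sigma_finite_measure set T2 -> \bar R}) (phi : T1 -> T3) :
  scales_measure 1 m1 n1 phi ->
  scales_measure 1 (product_measure1 m1 m2) (product_measure1 n1 m2)
    (fun p => (phi p.1, p.2)).
Proof.
move=> sphi; split=> [|A mA].
  apply: measurable_fun_pair; last exact: measurable_snd.
  by apply: measurableT_comp; [exact: sphi.1|exact: measurable_fst].
rewrite mul1e /product_measure1 -(ge0_integral_scales sphi)//.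
exact: measurable_fun_xsection.
Qed.

Section Split.
Context (R : realType).

Definition tuple_split k l (t : (k + l).-tuple (measurableTypeR R)) :=
  (tuple_of_row (lsubmx (row_of_tuple t)), tuple_of_row (rsubmx (row_of_tuple t))).

(** Induction on k: detach the head, split the tail, reassociate, and attach the head to the first
    part. *)
Lemma scales_tuple_split k l :
  scales_measure 1 (lebesgue_tuple (k + l))
    (product_measure1 (@lebesgue_tuple R k) (@lebesgue_tuple R l))
    (@tuple_split k l).
Proof.
elim: k => [|k IHk].
  have -> : @tuple_split 0 l = (fun t => ([tuple], t)).
    apply/funext => t; rewrite /tuple_split; congr pair; first exact: tuple0.
    rewrite -[RHS]row_of_tupleK; congr tuple_of_row; apply/rowP => j.
    by rewrite !mxE; congr tnth; exact: val_inj.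
  have mphi : measurable_fun setT (fun t : l.-tuple (measurableTypeR R) =>
      ([tuple] : 0.-tuple (measurableTypeR R), t)).
    by apply: measurable_fun_pair.
  split=> // A mA; rewrite mul1e /product_measure1 integral_dirac//.
    rewrite diracT mul1e /=; congr (lebesgue_tuple _ _).
    by apply/seteqP; split=> z; rewrite /xsection/= !inE.
  exact: measurable_fun_xsection.
have s1 := scales_tuple_uncons R (k + l).
have s2 : scales_measure 1
    (product_measure1 (@lebesgue_measure R) (@lebesgue_tuple R (k + l)))
    (product_measure1 (@lebesgue_measure R)
      (product_measure1 (@lebesgue_tuple R k) (@lebesgue_tuple R l)))
    (fun p => (p.1, tuple_split p.2)).
  split=> [|A mA].
    apply: measurable_fun_pair; first exact: measurable_fst.
    by apply: measurableT_comp; [exact: IHk.1|exact: measurable_snd].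
  rewrite mul1e; apply: eq_integral => x _ /=.
  rewrite -[RHS]mul1e -IHk.2; last exact: measurable_xsection.
  by congr (lebesgue_tuple _ _); apply/seteqP; split=> z; rewrite /xsection/= !inE.
have s3 := scales_assoc' (@lebesgue_measure R) (@lebesgue_tuple R k)
  (@lebesgue_tuple R l).
have s4 := scales_map_fst (@lebesgue_tuple R l) (scales_tuple_cons R k).
have := scales_comp (scales_comp (scales_comp s1 s2) s3) s4.
rewrite !mul1r; congr scales_measure; apply/funext => t.
rewrite -[t]tuple_unconsK; case: (tuple_uncons t) => x {}t.
rewrite /comp tuple_consK /=.
rewrite /tuple_split row_tuple_cons -[row_of_tuple t]hsubmxK.
set y := lsubmx _; set z := rsubmx _.
rewrite -[tuple_cons _]row_of_tupleK row_tuple_cons tuple_of_rowK.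
congr pair; congr tuple_of_row; apply/rowP => j.
  rewrite !mxE; case: splitP => i ji; case: splitP => i' /= ji'.
  - by rewrite (_ : i = i')//; apply: val_inj; rewrite /= -ji -ji'.
  - by have := ltn_ord i; rewrite -ji ji' ltnNge leq_addr.
  - by have := ltn_ord i'; rewrite -ji' ji ltnNge leq_addr.
  rewrite (_ : i' = lshift l i) ?row_mxEl /y ?row_mxKl//; apply: val_inj.
  by apply/eqP; rewrite /= -(eqn_add2l 1) -ji' ji.
rewrite /z row_mxKr [RHS]mxE [RHS]mxE; case: splitP => i /= ji.
  by have := ltn_ord i; rewrite -ji ltnS leqn0.
rewrite (_ : i = rshift k j) ?row_mxEr//; apply: val_inj.
by apply/eqP; rewrite /= -(eqn_add2l 1) -ji addnA.
Qed.

End Split.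

(** * Fundamental domains of countable groups *)

Section FundamentalDomains.
Context d (T : measurableType d) (R : realType) (mu : {measure set T -> \bar R}).
Context (e : nat -> T -> T).

(* The e_j may repeat, so no e_j is assumed to differ from e_i for j <> i. *)
Definition fundamental_set (D : set T) :=
  [/\ measurable D,
      {ae mu, forall x, exists j, D (e j x)} &
      forall j, (exists x, e j x <> x) -> mu.-negligible (D `&` e j @^-1` D)].

Definition measure_preserving_group :=
  [/\ forall j, scales_measure 1 mu mu (e j),
      forall i j, exists k, e k =1 e i \o e j &
      forall j, exists k, cancel (e j) (e k) /\ cancel (e k) (e j)].

Context (eG : measure_preserving_group).

(** Almost every point of [D1] is moved by the first [e j] that brings it into [D2]. The argument
    does not show that the moved points fill [D2], hence an inequality; exchanging the domains gives
    the other one. All pieces stay inside [D1] or [D2], where [f] is known to be measurable. *)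
Lemma ge0_le_integral_fundamental_set (D1 D2 : set T) (f : T -> \bar R) :
  fundamental_set D1 -> fundamental_set D2 ->
  (forall x, 0 <= f x)%E -> (forall j x, f (e j x) = f x) ->
  measurable_fun D1 f -> measurable_fun D2 f ->
  (\int[mu]_(x in D1) f x <= \int[mu]_(x in D2) f x)%E.
Proof.
case: eG => eS eM eV [mD1 _ D1null] [mD2 D2cov _] f0 fe mf1 mf2.
have /choice[k kP] := eV.
pose Z j := [set x | (exists y, e j y <> y) /\ (D1 `&` e j @^-1` D1) x].
(* [B] contains the points with no translate in [D2] and the overlaps of [D1] with its translates by
   maps other than the identity; countability of the family keeps it null. *)
have [B [mB B0 subB]] : mu.-negligible
    ([set x | ~ exists j, D2 (e j x)] `|` \bigcup_j Z j).
  apply: negligibleU => //; apply: negligible_bigcup => j.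
  have [ej|ej] := pselect (exists y, e j y <> y).
    by apply: (negligibleS _ (D1null j ej)) => x [].
  by apply: (negligibleS _ (negligible_set0 mu)) => x [].
have mpre j A : measurable A -> measurable (e j @^-1` A).
  exact: (scales_measurable (eS j)).
pose A j := (D1 `&` e j @^-1` D2) `\` B.
have mA j : measurable (A j).
  by apply: measurableD => //; apply: measurableI => //; exact: mpre.
(* Up to the null set B, the pieces E_j partition D1 and their translates by e_j
   are disjoint subsets of D2. *)
pose E := seqDU A.
have mE j : measurable (E j).
  by apply: measurableD => //; exact: bigsetU_measurable.
have EA j : E j `<=` A j by exact: subDsetl.
have D1E : D1 `\` B = \bigcup_j E j.
  rewrite -seqDU_bigcup_eq; apply/seteqP; split=> [x [D1x Bx]|x [j _ [[? _] ?]]//].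
  have [j D2x] : exists j, D2 (e j x).
    by apply: contrapT => nx; apply: Bx; apply: subB; left.
  by exists j.
have mfE : measurable_fun (\bigcup_j E j) f.
  by rewrite -D1E; apply: measurable_funS mf1 => //; exact: subDsetl.
rewrite (ge0_negligible_integral mB mD1 mf1)// D1E ge0_integral_bigcup//; last first.
  exact: trivIset_seqDU.
pose F j := e (k j) @^-1` E j.
have mF j : measurable (F j) by exact: mpre.
have FD2 j : F j `<=` D2.
  by move=> y /EA[[_]] /=; rewrite (kP j).2.
have EF j : E j = e j @^-1` F j.
  by apply/seteqP; split=> x; rewrite /F /preimage/= (kP j).1.
have mfF : measurable_fun (\bigcup_j F j) f.
  apply: measurable_funS mf2 => //.
  by move=> x [j _]; exact: FD2.
have intEF j : (\int[mu]_(x in E j) f x = \int[mu]_(x in F j) f x)%E.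
  have mfj : measurable_fun (F j) f := measurable_funS mD2 (@FD2 j) mf2.
  rewrite -(ge0_integral_scales (eS j) (mF j) mfj)// -EF.
  by apply: eq_integral => x _; rewrite /= fe.
rewrite (eq_eseriesr (fun j _ => intEF j)).
rewrite -ge0_integral_bigcup//; last first.
  (* If y lies in F_i and F_j, its preimages under e_i and e_j both lie in [D1], and a group element
     maps the second to the first. Were they distinct, the second would lie in an overlap removed
     with [B]; being equal, they lie in both E_i and E_j, so i = j. *)
  apply/trivIsetP => i j _ _; apply: contraNeq => /set0P[y [Fi Fj]].
  apply/eqP.
  have [[[D1i _] _] [[D1j _] Bj]] := (EA _ _ Fi, EA _ _ Fj).
  have [l lE] := eM (k i) j.
  have eij : e (k i) y = e (k j) y.
    apply: contrapT => ne; apply: Bj; apply: subB; right; exists l => //.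
    split; last by split=> //=; rewrite lE /= (kP j).2.
    by exists (e (k j) y); rewrite lE /= (kP j).2.
  apply: contrapT => ij.
  have /trivIsetP/(_ i j I I (introN eqP ij)) Eij := @trivIset_seqDU T A.
  suff : set0 (e (k i) y) by [].
  by rewrite -Eij; split=> //; rewrite eij.
apply: ge0_subset_integral => //; first exact: bigcup_measurable.
by move=> x [j _]; exact: FD2.
Qed.

Theorem eq_integral_fundamental_set (D1 D2 : set T) (f : T -> \bar R) :
  fundamental_set D1 -> fundamental_set D2 -> (forall j x, f (e j x) = f x) ->
  measurable_fun D1 f -> measurable_fun D2 f ->
  (\int[mu]_(x in D1) f x = \int[mu]_(x in D2) f x)%E.
Proof.
move=> fD1 fD2 fe mf1 mf2; rewrite integralE [RHS]integralE.
have fpos j x : (f^\+ (e j x) = f^\+ x)%E by rewrite !funeposE fe.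
have fneg j x : (f^\- (e j x) = f^\- x)%E by rewrite !funenegE fe.
congr (_ - _)%E; apply/eqP; rewrite eq_le; apply/andP; split;
  apply: ge0_le_integral_fundamental_set => //;
  by [exact: measurable_funepos|exact: measurable_funeneg].
Qed.

End FundamentalDomains.

(** * The symplectic action on the Siegel upper half space *)

Section SymplecticBlocks.

Lemma Gamma_block h (a b c d : 'M[int]_h) :
  Gamma (block_mx a b c d) <->
  [/\ a^T *m c = c^T *m a, b^T *m d = d^T *m b &
      a^T *m d - c^T *m b = 1%:M].
Proof.
rewrite /Gamma /symplectic_form /=.
rewrite tr_block_mx !mulmx_block !mulmx0 !mulmx1 !addr0 !add0r !mulmxN !mulmx1.
rewrite !mulNmx; split.
  move=> /eq_block_mx[e1 e2 e3 e4]; split.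
  - by apply/eqP; rewrite -subr_eq0 addrC e1.
  - by apply/eqP; rewrite -subr_eq0 addrC e4.
  - by rewrite -e2 addrC.
move=> [e1 e2 e3]; congr block_mx.
- by rewrite e1 addNr.
- by rewrite -e3 addrC.
- have <- : d^T *m a - b^T *m c = 1%:M.
    by rewrite -[RHS]trmx1 -e3 linearB/= !trmx_mul !trmxK.
  by rewrite opprB addrC.
- by rewrite e2 addNr.
Qed.

(** With J the symplectic form, J^2 = -1, so multiplying M^T J M = J by -J on the left gives this
    integral formula for the inverse. *)
Definition symplectic_inv h (M : 'M[int]_(h + h)) :=
  - symplectic_form h *m M^T *m symplectic_form h.

Lemma symplectic_form_sqr h :
  symplectic_form h *m symplectic_form h = - 1%:M.
Proof.
rewrite /symplectic_form mulmx_block !mulmx0 !mul0mx mulmx1 mul1mx !addr0 !add0r.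
by rewrite (scalar_mx_block h h) opp_block_mx !oppr0.
Qed.

Lemma symplectic_invK h (M : 'M[int]_(h + h)) : Gamma M ->
  symplectic_inv M *m M = 1%:M.
Proof.
move=> GM; rewrite /symplectic_inv !mulNmx -!mulmxA (mulmxA _^T).
by rewrite [_ *m M]GM symplectic_form_sqr opprK.
Qed.

Lemma symplectic_invVK h (M : 'M[int]_(h + h)) : Gamma M ->
  M *m symplectic_inv M = 1%:M.
Proof. by move=> /symplectic_invK/mulmx1C. Qed.

Lemma Gamma_tr h (M : 'M[int]_(h + h)) : Gamma M ->
  M *m symplectic_form h *m M^T = symplectic_form h.
Proof.
move=> GM; have := symplectic_invVK GM.
rewrite /symplectic_inv !mulNmx mulmxN => /(congr1 (mulmx^~ (symplectic_form h))).
rewrite /= mulNmx mul1mx -!mulmxA symplectic_form_sqr.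
by rewrite !mulmxN opprK mulmx1 !mulmxA.
Qed.

Lemma Gamma_symplectic_inv h (M : 'M[int]_(h + h)) : Gamma M ->
  Gamma (symplectic_inv M).
Proof.
move=> GM; have MN := symplectic_invVK GM.
rewrite /Gamma/= -[X in X *m symplectic_inv M](_ : (symplectic_inv M)^T *m
  (M^T *m symplectic_form h *m M) = _); last by rewrite GM.
by rewrite -!mulmxA MN mulmx1 mulmxA -trmx_mul MN trmx1 mul1mx.
Qed.

Lemma det_Gamma h (M : 'M[int]_(h + h)) : Gamma M -> (\det M) ^+ 2 = 1.
Proof.
move=> GM; have J1 : \det (symplectic_form h) != 0 :> int.
  apply: contra_eq_neq (congr1 determinant (symplectic_form_sqr h)) => J0.
  by rewrite det_mulmx J0 mul0r -scaleN1r detZ det1 mulr1 eq_sym signr_eq0.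
have /(congr1 determinant) := GM.
rewrite !det_mulmx det_tr mulrAC => MJ.
by apply: (mulIf J1); rewrite mul1r.
Qed.

End SymplecticBlocks.

(** * Complex matrices through their real and imaginary parts *)

Section Complex.
Context (R : realType).
Local Notation C := R[i].

Definition real_mx m n (A : 'M[R]_(m, n)) : 'M[C]_(m, n) :=
  map_mx (real_complex R) A.

Definition conj_mx m n (A : 'M[C]_(m, n)) : 'M[C]_(m, n) :=
  map_mx (@conjc R) A.

Lemma complex_mxE m n (A B : 'M[R]_(m, n)) :
  complex_mx A B = real_mx A + 'i *: real_mx B.
Proof. by apply/matrixP => i j; rewrite !mxE; simpc. Qed.

Lemma real_mxE m n (A : 'M[R]_(m, n)) : real_mx A = complex_mx A 0.
Proof. by apply/matrixP => i j; rewrite !mxE. Qed.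

Lemma complex_mxP m n (A : 'M[C]_(m, n)) :
  A = complex_mx (map_mx (@complex.Re R) A) (map_mx (@complex.Im R) A).
Proof. by apply/matrixP => i j; rewrite !mxE; case: (A i j). Qed.

Lemma complex_mx_inj m n (A B A' B' : 'M[R]_(m, n)) :
  complex_mx A B = complex_mx A' B' -> A = A' /\ B = B'.
Proof.
move=> /matrixP AB; split; apply/matrixP => i j; have := AB i j;
  by rewrite !mxE => -[].
Qed.

Lemma Im_complex_mx m n (A B : 'M[R]_(m, n)) :
  map_mx (@complex.Im R) (complex_mx A B) = B.
Proof. by apply/matrixP => i j; rewrite !mxE. Qed.

Lemma tr_complex_mx m n (A B : 'M[R]_(m, n)) :
  (complex_mx A B)^T = complex_mx A^T B^T.
Proof. by apply/matrixP => i j; rewrite !mxE. Qed.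

Lemma conj_complex_mx m n (A B : 'M[R]_(m, n)) :
  conj_mx (complex_mx A B) = complex_mx A (- B).
Proof. by apply/matrixP => i j; rewrite !mxE. Qed.

Lemma add_complex_mx m n (A B A' B' : 'M[R]_(m, n)) :
  complex_mx A B + complex_mx A' B' = complex_mx (A + A') (B + B').
Proof. by apply/matrixP => i j; rewrite !mxE; simpc. Qed.

Lemma mul_complex_mx m n p (A B : 'M[R]_(m, n)) (A' B' : 'M[R]_(n, p)) :
  complex_mx A B *m complex_mx A' B' =
  complex_mx (A *m A' - B *m B') (A *m B' + B *m A').
Proof.
rewrite !complex_mxE /real_mx map_mxB map_mxD !map_mxM !mulmxDl !mulmxDr.
rewrite -!scalemxAl -!scalemxAr scalerA -expr2 sqr_i scaleN1r scalerDr.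
by rewrite [_ - _ in LHS]addrC addrACA.
Qed.

Lemma mul_real_complex_mx m n p (A : 'M[R]_(m, n)) (A' B' : 'M[R]_(n, p)) :
  real_mx A *m complex_mx A' B' = complex_mx (A *m A') (A *m B').
Proof. by rewrite real_mxE mul_complex_mx !mul0mx subr0 addr0. Qed.

End Complex.

HB.instance Definition _ (R : realType) :=
  GRing.RMorphism.copy (@intC R) (@intmul R[i] 1).

Section SiegelAction.
Context (R : realType).
Local Notation C := R[i].

Lemma conj_intC m n (A : 'M[int]_(m, n)) :
  conj_mx (map_mx (@intC R) A) = map_mx (@intC R) A.
Proof. by apply/matrixP => i j; rewrite !mxE /intC rmorph_int. Qed.

Lemma intC_real_mx m n (A : 'M[int]_(m, n)) :
  map_mx (@intC R) A = real_mx (map_mx (intmul 1) A).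
Proof. by apply/matrixP => i j; rewrite !mxE /intC rmorph_int. Qed.

(** For x = a + i b the form is a^T X a + b^T X b: the mixed terms cancel because X is symmetric,
    and a or b is nonzero. *)
Lemma posdef_complex h (X : 'M[R]_h) (x : 'cV[C]_h) : posdef X -> x != 0 ->
  exists2 r : R, 0 < r & ((conj_mx x)^T *m real_mx X *m x) = (r%:C)%:M.
Proof.
move=> [Xsym Xpos] x0; rewrite [x]complex_mxP in x0 *.
move: (map_mx _ x) (map_mx _ x) x0 => a b ab0.
rewrite conj_complex_mx tr_complex_mx real_mxE !mul_complex_mx.
rewrite !mulmx0 subr0 add0r linearN/= !mulNmx opprK.
have pos0 (y : 'cV[R]_h) : 0 <= (y^T *m X *m y) 0 0.
  have [->|y0] := eqVneq y 0; first by rewrite mulmx0 mxE.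
  exact/ltW/Xpos.
exists ((a^T *m X *m a + b^T *m X *m b) 0 0).
  rewrite mxE; have [a0|a0] := eqVneq a 0.
    apply: ltr_wpDl => //; apply: Xpos; apply: contraNneq ab0 => b0.
    by apply/eqP/matrixP => i j; rewrite a0 b0 !mxE.
  by apply: ltr_pwDl => //; exact: Xpos.
have -> : a^T *m X *m b = b^T *m X *m a.
  have -> : a^T *m X *m b = (a^T *m X *m b)^T.
    by apply/matrixP => i j; rewrite !ord1 [RHS]mxE.
  by rewrite !trmx_mul trmxK Xsym mulmxA.
rewrite subrr addrC [LHS]mx11_scalar; congr (scalar_mx _).
by rewrite mxE [X in _ +i* X]mxE.
Qed.

Lemma SiegelP h (tau : 'M[C]_h) : Siegel tau ->
  exists X Y : 'M[R]_h, [/\ tau = complex_mx X Y, X^T = X & posdef Y].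
Proof.
move=> [tausym taupos]; exists (map_mx (@complex.Re R) tau), (map_mx (@complex.Im R) tau).
split=> //; first exact: complex_mxP.
by rewrite map_trmx tausym.
Qed.

Lemma Siegel_complex_mx h (X Y : 'M[R]_h) : X^T = X -> posdef Y ->
  Siegel (complex_mx X Y).
Proof.
move=> Xsym Ypos; split; last by rewrite Im_complex_mx.
by rewrite tr_complex_mx Xsym Ypos.1.
Qed.

(* Used with sigma = tau (symmetry of the image, as the right-hand side vanishes)
   and with sigma the conjugate of tau (its imaginary part). *)
Lemma Siegel_symplectic_pairing h (M : 'M[int]_(h + h)) (sigma tau : 'M[C]_h)
    (N := map_mx (@intC R) M) : Gamma M ->
  (sigma *m (ulsubmx N)^T + (ursubmx N)^T) *m (dlsubmx N *m tau + drsubmx N) -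
  (sigma *m (dlsubmx N)^T + (drsubmx N)^T) *m (ulsubmx N *m tau + ursubmx N) =
  sigma - tau.
Proof.
move=> GM; have {GM} : N^T *m block_mx 0 1%:M (- 1%:M) 0 *m N =
    block_mx 0 1%:M (- 1%:M) 0.
  have := congr1 (map_mx (@intC R)) GM.
  by rewrite !map_mxM map_trmx map_block_mx map_mxN map_mx1 !map_mx0.
rewrite -[N in _ *m N = _]submxK -[in N^T](submxK N) tr_block_mx !mulmx_block.
rewrite !mulmx0 !mulmx1 !addr0 !add0r !mulmxN !mulmx1 !mulNmx.
move: (ulsubmx N) (ursubmx N) (dlsubmx N) (drsubmx N) => a b c d.
move=> /eq_block_mx[e1 e2 e3 e4].
rewrite !mulmxDl !mulmxDr !mulmxA.
have -> : sigma *m a^T *m c = sigma *m c^T *m a.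
  by rewrite -!mulmxA; congr (_ *m _); apply/eqP; rewrite -subr_eq0 addrC e1.
have -> : b^T *m d = d^T *m b by apply/eqP; rewrite -subr_eq0 addrC e4.
have -> : sigma *m a^T *m d = sigma + sigma *m c^T *m b.
  by rewrite -!mulmxA -[X in X + _]mulmx1 -e2 mulmxDr mulmxN addrAC addNr add0r.
have -> : d^T *m a *m tau = tau + b^T *m c *m tau.
  rewrite -[X in X + _]mul1mx -[X in X *m tau + _]opprK -e3.
  by rewrite opprD opprK mulmxDl mulNmx subrK.
rewrite -[tau + _ + _]addrA !addrA.
set p := sigma *m c^T *m a *m tau; set q := sigma *m c^T *m b.
set r := b^T *m c *m tau; set t := d^T *m b.
have -> : p + sigma + q + r + t = sigma + (r + t) + (p + q).
  by rewrite [LHS](ACl (2*(4*5)*(1*3))).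
have -> : p + q + tau + r + t = tau + (r + t) + (p + q).
  by rewrite [LHS](ACl (3*(4*5)*(1*2))).
by rewrite opprD addrACA subrr addr0 opprD addrACA subrr addr0.
Qed.

Lemma conj_complex_mx_sub m n (X Y : 'M[R]_(m, n)) :
  conj_mx (complex_mx X Y) - complex_mx X Y = (0 +i* (-2%:R)) *: real_mx Y.
Proof.
apply/matrixP => i j; rewrite !mxE; apply/eqP; rewrite eq_complex /=.
by apply/andP; split; apply/eqP; ring.
Qed.

Lemma tr_conj_mx m n (A : 'M[C]_(m, n)) : (conj_mx A)^T = conj_mx A^T.
Proof. by rewrite /conj_mx map_trmx. Qed.

Lemma conj_Siegel_denominator h (M : 'M[int]_(h + h)) (tau : 'M[C]_h)
    (N := map_mx (@intC R) M) : tau^T = tau ->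
  conj_mx tau *m (dlsubmx N)^T + (drsubmx N)^T =
  (conj_mx (dlsubmx N *m tau + drsubmx N))^T.
Proof.
move=> tausym; have NJ : map_mx (@conjc R) N = N := conj_intC M.
rewrite /conj_mx map_mxD map_mxM map_dlsubmx map_drsubmx NJ linearD/= trmx_mul.
by rewrite map_trmx tausym.
Qed.

Lemma conj_Siegel_numerator h (M : 'M[int]_(h + h)) (tau : 'M[C]_h)
    (N := map_mx (@intC R) M) : tau^T = tau ->
  conj_mx tau *m (ulsubmx N)^T + (ursubmx N)^T =
  (conj_mx (ulsubmx N *m tau + ursubmx N))^T.
Proof.
move=> tausym; have NJ : map_mx (@conjc R) N = N := conj_intC M.
rewrite /conj_mx map_mxD map_mxM map_ulsubmx map_ursubmx NJ linearD/= trmx_mul.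
by rewrite map_trmx tausym.
Qed.

(** On a vector killed by the denominator, the left side of the pairing with sigma the conjugate of
    tau vanishes, whereas the right side is a nonzero multiple of a value of the positive definite
    hermitian form given by Im tau. *)
Lemma Siegel_denominator_unit h (M : 'M[int]_(h + h)) (tau : 'M[C]_h)
    (N := map_mx (@intC R) M) : Gamma M -> Siegel tau ->
  dlsubmx N *m tau + drsubmx N \in unitmx.
Proof.
move=> GM Stau; have [X [Y [tauE _ Ypos]]] := SiegelP Stau.
have := Siegel_symplectic_pairing (conj_mx tau) tau GM; rewrite -/N.
rewrite conj_Siegel_denominator; last by case: Stau.
set q := dlsubmx N *m tau + drsubmx N => pairing.
rewrite unitmxE unitfE -det_tr; apply/negP => /det0P[v v0 vq].
have qv : q *m v^T = 0 by rewrite -[LHS]trmxK trmx_mul trmxK vq trmx0.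
have qv' : conj_mx v *m (conj_mx q)^T = 0.
  by rewrite tr_conj_mx /conj_mx -map_mxM vq map_mx0.
have {pairing} := congr1 (fun A => conj_mx v *m A *m v^T) pairing.
rewrite mulmxBr mulmxBl mulmxA mulmxA qv' !mul0mx subr0 -!mulmxA qv !mulmx0.
have vT0 : v^T != 0 by rewrite trmx_eq0.
have [r r0] := posdef_complex Ypos vT0; rewrite tr_conj_mx trmxK => vYv.
rewrite tauE conj_complex_mx_sub -scalemxAl -scalemxAr mulmxA vYv.
move=> /matrixP/(_ 0 0); rewrite !mxE eqxx mulr1n; simpc => -[/eqP].
by rewrite eq_sym oppr_eq0 mulf_eq0 pnatr_eq0/= gt_eqF.
Qed.

Lemma Siegel_actK h (M : 'M[int]_(h + h)) (tau : 'M[C]_h)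
    (N := map_mx (@intC R) M) : Gamma M -> Siegel tau ->
  Siegel_act M tau *m (dlsubmx N *m tau + drsubmx N) =
  ulsubmx N *m tau + ursubmx N.
Proof.
move=> GM Stau; rewrite /Siegel_act -/N -mulmxA mulVmx ?mulmx1//.
exact: Siegel_denominator_unit.
Qed.

Lemma Siegel_act_unique h (M : 'M[int]_(h + h)) (tau sigma : 'M[C]_h)
    (N := map_mx (@intC R) M) : Gamma M -> Siegel tau ->
  sigma *m (dlsubmx N *m tau + drsubmx N) = ulsubmx N *m tau + ursubmx N ->
  Siegel_act M tau = sigma.
Proof.
move=> GM Stau sigmaE; rewrite /Siegel_act -/N -sigmaE -mulmxA mulmxV ?mulmx1//.
exact: Siegel_denominator_unit.
Qed.

Lemma Siegel_Siegel_act h (M : 'M[int]_(h + h)) (tau : 'M[C]_h) :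
  Gamma M -> Siegel tau -> Siegel (Siegel_act M tau).
Proof.
move=> GM Stau; have [X [Y [tauE _ Ypos]]] := SiegelP Stau.
have [tausym _] := Stau.
have := Siegel_symplectic_pairing (conj_mx tau) tau GM.
have := Siegel_symplectic_pairing tau tau GM.
have := Siegel_actK GM Stau.
have := Siegel_denominator_unit GM Stau.
rewrite conj_Siegel_denominator// conj_Siegel_numerator// subrr.
set N := map_mx (@intC R) M; set tau' := Siegel_act M tau.
set q := dlsubmx N *m tau + drsubmx N; set p := ulsubmx N *m tau + ursubmx N.
have -> : tau *m (ulsubmx N)^T + (ursubmx N)^T = p^T.
  by rewrite /p linearD/= trmx_mul tausym.
have -> : tau *m (dlsubmx N)^T + (drsubmx N)^T = q^T.
  by rewrite /q linearD/= trmx_mul tausym.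
move=> qU tau'q /eqP; rewrite subr_eq0 => /eqP pq pairing.
have qK := mulmxV qU; have Kq := mulVmx qU.
have tau'sym : tau'^T = tau'.
  have qTU : q^T \in unitmx by rewrite unitmx_tr.
  apply: (can_inj (mulKmx qTU)); apply: (can_inj (mulmxK qU)).
  by rewrite -trmx_mul -[RHS]mulmxA tau'q pq.
have [X' [T tau'E]] : exists X' T : 'M[R]_h, tau' = complex_mx X' T.
  by do 2 eexists; exact: complex_mxP.
have [X'sym Tsym] : X'^T = X' /\ T^T = T.
  by apply: complex_mx_inj; rewrite -tr_complex_mx -tau'E.
rewrite tau'E; apply: Siegel_complex_mx => //; split=> // y y0.
have y0' : real_mx y != 0.
  by apply: contraNneq y0 => /matrixP y0; apply/eqP/matrixP => i j;
    have := y0 i j; rewrite !mxE => -[].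
(* Writing y = q x turns the pairing into y^T T y = conj(x)^T Y x, with T and Y the imaginary parts
   of tau' and tau, so positivity passes from Y to T. *)
have [x qx] : exists x, q *m x = real_mx y.
  by exists (invmx q *m real_mx y); rewrite mulKVmx.
have px : p *m x = tau' *m real_mx y by rewrite -tau'q -mulmxA qx.
have x0 : x != 0 by apply: contraNneq y0' => x0; rewrite -qx x0 mulmx0.
have yJ : conj_mx (real_mx y) = real_mx y.
  by rewrite real_mxE conj_complex_mx oppr0.
have xq : (conj_mx x)^T *m (conj_mx q)^T = (real_mx y)^T.
  by rewrite -trmx_mul /conj_mx -map_mxM qx -/(conj_mx _) yJ.
have xp : (conj_mx x)^T *m (conj_mx p)^T = (real_mx y)^T *m conj_mx tau'.
  rewrite -trmx_mul /conj_mx -map_mxM px map_mxM trmx_mul -!/(conj_mx _) yJ.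
  by rewrite tr_conj_mx tau'sym.
have := posdef_complex Ypos x0 => -[r r0 xYx].
have := congr1 (fun A => (conj_mx x)^T *m A *m x) pairing.
rewrite mulmxBr mulmxBl !mulmxA xp xq -!mulmxA qx px -mulmxBr -mulmxBl.
rewrite tauE tau'E !conj_complex_mx_sub -!scalemxAl -!scalemxAr !mulmxA xYx.
rewrite /real_mx map_trmx -!map_mxM => /matrixP/(_ 0 0).
rewrite !mxE eqxx mulr1n; simpc => -[/oppr_inj/mulfI yTy].
by rewrite yTy// pnatr_eq0.
Qed.

End SiegelAction.

(** * Iwasawa coordinates *)

Section IwasawaDecomposition.
Context (R : realType).

Lemma sqrt_diag_sqr h (v : 'rV[R]_h) : (forall i, 0 < v 0 i) ->
  sqrt_diag v ^+ 2 = diag_mx v.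
Proof.
move=> v0; rewrite expr2 -[LHS]/(_ *m _) mulmx_diag; congr diag_mx.
by apply/rowP => i; rewrite !mxE -expr2 sqr_sqrtr// ltW.
Qed.

Lemma posdef_unitmx h (Y : 'M[R]_h) : posdef Y -> Y \in unitmx.
Proof.
move=> [Ysym Ypos]; rewrite unitmxE unitfE; apply/negP => /det0P[v v0 vY].
have : v^T != 0 by rewrite trmx_eq0.
by move=> /Ypos; rewrite trmxK vY mul0mx mxE ltxx.
Qed.

Lemma unitriangular_block h (u : 'rV[R]_h) (U : 'M[R]_h) : unitriangular U ->
  unitriangular (block_mx (1%:M : 'M[R]_1) u 0 U : 'M[R]_h.+1).
Proof.
move=> Utri; have E (i j : 'I_(1 + h)) : (j <= i)%N ->
    block_mx (1%:M : 'M[R]_1) u 0 U i j = (i == j)%:R.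
  case: (fintype.split_ordP i) => i' ->; case: (fintype.split_ordP j) => j' ->.
  - by rewrite block_mxEul !ord1 mxE eqxx.
  - by rewrite /= ord1.
  - by rewrite block_mxEdl mxE eq_rlshift.
  - by rewrite block_mxEdr eq_rshift /= !add1n ltnS => /Utri.
exact: E.
Qed.

Lemma det_unitriangular h (U : 'M[R]_h) : unitriangular U -> \det U = 1.
Proof.
move=> Utri; rewrite -det_tr det_trig.
  by apply: big1 => i _; rewrite mxE Utri// eqxx.
apply/is_trig_mxP => i j ij.
by rewrite mxE Utri ?(ltnW ij)// -val_eqE gtn_eqF.
Qed.

Lemma posdef_drsubmx h (Y : 'M[R]_(1 + h)) : posdef Y -> posdef (drsubmx Y).
Proof.
move=> [Ysym Ypos]; split; first by rewrite trmx_drsub Ysym.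
move=> x x0; have : col_mx (0 : 'M[R]_1) x != 0.
  by apply: contraNneq x0 => /(congr1 dsubmx); rewrite col_mxKd linear0 => ->.
move=> /Ypos; rewrite -{1}[Y]submxK tr_col_mx mul_row_block mul_row_col.
by rewrite !trmx0 !mul0mx !mulmx0 !add0r.
Qed.

(* One step of the Cholesky-type recursion: d is the new Iwasawa coordinate v_1
   and la U the new first row of the unitriangular factor. *)
Lemma posdef_block h (Y : 'M[R]_(1 + h)) (Y' := drsubmx Y) : posdef Y ->
  exists (la : 'rV[R]_h) (d : R), 0 < d /\
    Y = block_mx (d%:M + la *m Y' *m la^T) (la *m Y') (Y' *m la^T) Y'.
Proof.
move=> Ypos; have Y'pos : posdef Y' := posdef_drsubmx Ypos.
have Y'U := posdef_unitmx Y'pos; have [Ysym Yp] := Ypos.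
exists (ursubmx Y *m invmx Y').
set la := _ *m invmx Y'; have laY : la *m Y' = ursubmx Y by rewrite mulmxKV.
have Yla : Y' *m la^T = dlsubmx Y.
  by rewrite -Y'pos.1 -trmx_mul laY trmx_ursub Ysym.
have dE := mx11_scalar (ulsubmx Y - la *m Y' *m la^T).
exists ((ulsubmx Y - la *m Y' *m la^T) 0 0); split; last first.
  by rewrite -dE subrK laY Yla submxK.
have x0 : col_mx (1%:M : 'M[R]_1) (- la^T) != 0.
  apply/eqP => /(congr1 usubmx); rewrite col_mxKu linear0 => /matrixP/(_ 0 0).
  by rewrite !mxE => /eqP; rewrite oner_eq0.
have := Yp _ x0; rewrite -{1}[Y]submxK tr_col_mx linearN/= trmxK trmx1.
rewrite mul_row_block mul_row_col !mul1mx mulmx1 !mulNmx.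
by rewrite -/Y' laY subrr mul0mx addr0 -laY -mulmxA Yla.
Qed.

Lemma block_Iwasawa h (U D : 'M[R]_h) (la : 'rV[R]_h) (d : R)
    (Y := U *m D *m U^T) :
  block_mx (d%:M + la *m Y *m la^T) (la *m Y) (Y *m la^T) Y =
  block_mx (1%:M : 'M[R]_1) (la *m U) 0 U *m block_mx d%:M 0 0 D *m
    (block_mx (1%:M : 'M[R]_1) (la *m U) 0 U)^T.
Proof.
rewrite tr_block_mx !mulmx_block !mul0mx !mulmx0 !mul1mx !addr0 !add0r trmx1 trmx0.
by rewrite !mulmx0 !mulmx1 !add0r trmx_mul !mulmxA.
Qed.

Theorem posdef_Iwasawa h (Y : 'M[R]_h) : posdef Y ->
  exists (U : 'M[R]_h) (v : 'rV[R]_h), [/\ unitriangular U, forall i, 0 < v 0 i &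
    Y = U *m sqrt_diag v ^+ 2 *m U^T].
Proof.
elim: h Y => [|h IHh] Y Ypos.
  exists 0, 0; split; [by case|by case|by rewrite [LHS]flatmx0 [RHS]flatmx0].
have [U [v [Utri v0 Y'E]]] := IHh _ (@posdef_drsubmx h Y Ypos).
have [la [d [d0 YE]]] := @posdef_block h Y Ypos.
exists (block_mx (1%:M : 'M[R]_1) (la *m U) 0 U).
exists (row_mx (d%:M : 'M[R]_1) v).
have w0 i : 0 < (row_mx (d%:M : 'M[R]_1) v : 'rV[R]_h.+1) 0 i.
  have : forall i : 'I_(1 + h), 0 < row_mx (d%:M : 'M[R]_1) v 0 i.
    move=> {}i; case: (fintype.split_ordP i) => i' ->.
      by rewrite row_mxEl mxE ord1 eqxx mulr1n.
    by rewrite row_mxEr.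
  exact.
split=> //; first exact: unitriangular_block.
rewrite sqrt_diag_sqr// [LHS]YE Y'E block_Iwasawa.
rewrite sqrt_diag_sqr// -{1}(_ : diag_mx (d%:M : 'M[R]_1) = d%:M); last first.
  by apply/matrixP => i j; rewrite !ord1 !mxE eqxx mulr1n.
by congr (_ *m _ *m _); rewrite -diag_mx_row.
Qed.

(** [Iwasawa] chooses a triple, with (0, 0, 0) as default; the decomposition of Im tau shows that a
    triple exists, so the choice is a genuine one. *)
Lemma IwasawaP h (tau : 'M[R[i]]_h) : Siegel tau -> is_Iwasawa tau (Iwasawa tau).
Proof.
move=> /SiegelP[X [Y [-> Xsym /posdef_Iwasawa[U [v [Utri v0 YE]]]]]].
by apply: (@xgetPex _ _ (is_Iwasawa _)); exists (X, U, v); split=> //; rewrite YE.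
Qed.

End IwasawaDecomposition.

(** * Heisenberg coordinates *)

Lemma mx11_tr (R : Type) (A : 'M[R]_1) : A^T = A.
Proof. by apply/matrixP => i j; rewrite !ord1 mxE. Qed.

Lemma dot_rowC (R : comPzRingType) k (x y : 'rV[R]_k) :
  (x *m y^T) 0 0 = (y *m x^T) 0 0.
Proof. by rewrite -[in LHS](mx11_tr (x *m _)) trmx_mul trmxK. Qed.

Section HeisenbergCoordinates.
Context (R : realType) (k : nat).
Local Notation C := R[i].
Local Notation intR := (map_mx (intmul (1 : R))).

(* The point (tau_1, tau_2) with Heisenberg coordinates kap and z = (la, mu). *)
Definition heisenberg_point (v : R) (tau : 'M[C]_k) (kap : R)
    (z : 'rV[R]_(k + k)) : C * 'rV[C]_k :=
  let t2 := real_mx (lsubmx z) *m tau + real_mx (rsubmx z) in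
  (kap +i* v + (real_mx (lsubmx z) *m t2^T) 0 0, t2).

Lemma heisenberg_act_point v (tau : 'M[C]_k) kap z (m n : 'rV[int]_k) q :
  tau^T = tau ->
  heisenberg_act tau m n q (heisenberg_point v tau kap z) =
  heisenberg_point v tau
    (kap + q%:~R + (intR m *m (rsubmx z)^T - lsubmx z *m (intR n)^T) 0 0)
    (z + row_mx (intR m) (intR n)).
Proof.
move=> tausym; rewrite /heisenberg_act /heisenberg_point /= !intC_real_mx.
rewrite !linearD/= row_mxKl row_mxKr /real_mx !map_mxD.
rewrite -!/(real_mx _).
set la := real_mx (lsubmx z); set mu := real_mx (rsubmx z).
set M := real_mx (intR m); set N := real_mx (intR n).
congr pair; last by rewrite mulmxDl [in RHS]addrACA addrA.
have -> : (kap + q%:~R + (intR m *m (rsubmx z)^T - lsubmx z *m (intR n)^T) 0 0)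
    +i* v = kap +i* v + intC R q + ((M *m mu^T) 0 0 - (la *m N^T) 0 0).
  have E (x y : 'rV[R]_k) : (real_mx x *m (real_mx y)^T) 0 0 = ((x *m y^T) 0 0)%:C.
    by rewrite /real_mx map_trmx -map_mxM mxE.
  rewrite !E [in LHS]mxE [X in _ + (_ + X)]mxE /intC -(rmorph_int (real_complex R)).
  by apply/eqP; rewrite eq_complex /=; apply/andP; split; apply/eqP; ring.
move: (kap +i* v) (intC R q) la mu M N => c c' la mu M N.
rewrite !(linearD, mulmxDl, mulmxDr, trmx_mul)/= tausym.
have -> : M *m (tau *m la^T) = la *m (tau *m M^T).
  by rewrite -[LHS]mx11_tr !trmx_mul trmxK tausym mulmxA.
have -> : N *m M^T = M *m N^T by rewrite -[LHS]mx11_tr trmx_mul trmxK.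
rewrite -!mulmxA; move: (la *m (tau *m la^T)) (la *m (tau *m M^T)) (la *m mu^T)
  (M *m (tau *m M^T)) (M *m mu^T) (la *m N^T) (M *m N^T) => x1 x2 x3 x4 x5 x6 x7.
by rewrite !mxE; ring.
Qed.

Lemma neg_heisenberg_point v (tau : 'M[C]_k) kap z :
  heisenberg_point v tau kap (- z) =
  ((heisenberg_point v tau kap z).1, - (heisenberg_point v tau kap z).2).
Proof.
rewrite /heisenberg_point /= !linearN /real_mx !map_mxN !mulNmx -opprD.
by rewrite linearN/= mulmxN opprK.
Qed.

Lemma Siegel_bordered v (tau : 'M[C]_k) kap z : 0 < v -> Siegel tau ->
  Siegel (bordered (heisenberg_point v tau kap z) tau).
Proof.
move=> v0 /SiegelP[X [Y [-> Xsym [Ysym Ypos]]]].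
rewrite /bordered /heisenberg_point /=.
set la := lsubmx z; set mu := rsubmx z.
rewrite [real_mx mu]real_mxE mul_real_complex_mx add_complex_mx addr0.
rewrite tr_complex_mx mul_real_complex_mx.
set w := la *m X + mu; set u := la *m Y.
have -> : ((kap +i* v + complex_mx (la *m w^T) (la *m u^T) 0 0)%:M : 'M[C]_1) =
    complex_mx (kap%:M + la *m w^T) (v%:M + la *m u^T).
  by apply/matrixP => i j; rewrite !ord1 !mxE eqxx !mulr1n.
have -> : block_mx (complex_mx (kap%:M + la *m w^T) (v%:M + la *m u^T))
    (complex_mx w u) (complex_mx w^T u^T) (complex_mx X Y) =
  complex_mx (block_mx (kap%:M + la *m w^T) w w^T X)
    (block_mx (v%:M + la *m u^T) u u^T Y).
  apply/matrixP => i j; rewrite [RHS]mxE.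
  case: (fintype.split_ordP i) => i' ->; case: (fintype.split_ordP j) => j' ->;
  by rewrite ?(block_mxEul, block_mxEur, block_mxEdl, block_mxEdr) mxE.
apply: (@Siegel_complex_mx R (1 + k)).
  by rewrite tr_block_mx trmxK Xsym mx11_tr.
split; first by rewrite tr_block_mx trmxK Ysym mx11_tr.
move=> x x0; have [y [t xE]] : exists (y : R) (t : 'cV[R]_k), x = col_mx y%:M t.
  exists (usubmx (x : 'cV[R]_(1 + k)) 0 0), (dsubmx (x : 'cV[R]_(1 + k))).
  by rewrite -mx11_scalar vsubmxK.
(* Completing the square: shifting t by y la^T separates v y^2 from the form Y. *)
have E : (x^T *m block_mx (v%:M + la *m u^T) u u^T Y *m x) 0 0 =
    v * y ^+ 2 + ((t + y *: la^T)^T *m Y *m (t + y *: la^T)) 0 0.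
  have addE (A B : 'M[R]_1) : (A + B) 0 0 = A 0 0 + B 0 0 by rewrite mxE.
  have vE : (v%:M : 'M[R]_1) 0 0 = v by rewrite mxE eqxx mulr1n.
  have scaleE a (A : 'M[R]_1) : (a *: A) 0 0 = a * A 0 0 by rewrite mxE.
  rewrite xE tr_col_mx mul_row_block mul_row_col tr_scalar_mx.
  rewrite !(mulmxDl, mulmxDr, linearD)/= ?linearZ/= trmxK /u trmx_mul Ysym.
  rewrite !(mul_scalar_mx, mul_mx_scalar, mulmxDl, mulmxDr) -?scalemxAl -?scalemxAr.
  rewrite !addE !scaleE.
  rewrite !mulmxA vE; ring.
rewrite E; have [y0|y0] := eqVneq y 0.
  rewrite y0 scale0r addr0 expr0n mulr0 add0r; apply: Ypos.
  by apply: contraNneq x0 => t0; rewrite xE t0 y0 raddf0 col_mx0.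
apply: ltr_pwDl; first by rewrite mulr_gt0// exprn_even_gt0.
have [->|/Ypos/ltW//] := eqVneq (t + y *: la^T) 0.
by rewrite mulmx0 mxE.
Qed.

End HeisenbergCoordinates.

(** * Parabolic elements and the embedded Gamma_k: invariance of the integrand *)

Lemma congr_block_mx (T : Type) m1 m2 n1 n2 (A A' : 'M[T]_(m1, n1))
    (B B' : 'M[T]_(m1, n2)) (C C' : 'M[T]_(m2, n1)) (D D' : 'M[T]_(m2, n2)) :
  A = A' -> B = B' -> C = C' -> D = D' ->
  block_mx A B C D = block_mx A' B' C' D'.
Proof. by move=> -> -> -> ->. Qed.

(* A' is the inverse transpose of A; this element acts by
   sigma |-> A sigma A^T + B. *)
Lemma Gamma_shear h (A A' B : 'M[int]_h) : A^T *m A' = 1%:M -> B^T = B ->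
  Gamma (block_mx A (B *m A') 0 A').
Proof.
move=> AA' Bsym; apply/Gamma_block; split.
- by rewrite trmx0 mulmx0 mul0mx.
- by rewrite trmx_mul Bsym mulmxA.
- by rewrite trmx0 mul0mx subr0.
Qed.

(** M acts on the last k pairs of symplectic coordinates, the identity on the first pair. *)
Definition Gamma_embed k (M : 'M[int]_(k + k)) : 'M[int]_((1 + k) + (1 + k)) :=
  block_mx (block_mx 1%:M 0 0 (ulsubmx M)) (block_mx 0 0 0 (ursubmx M))
    (block_mx 0 0 0 (dlsubmx M)) (block_mx 1%:M 0 0 (drsubmx M)).

Lemma Gamma_Gamma_embed k (M : 'M[int]_(k + k)) :
  Gamma M -> @Gamma (1 + k) (Gamma_embed M).
Proof.
rewrite -{1}[M]submxK => /Gamma_block[e1 e2 e3]; apply/Gamma_block.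
rewrite !tr_block_mx !mulmx_block !trmx0 !mulmx0 !mul0mx !addr0 !add0r trmx1.
rewrite !mulmx1 e1 e2; split=> //.
by rewrite opp_block_mx add_block_mx e3 !subr0 -scalar_mx_block.
Qed.

Section Invariance.
Context (R : realType) (k : nat).
Local Notation C := R[i].
Local Notation intR := (map_mx (intmul (1 : R))).

Lemma Siegel_act_shear h (A A' B : 'M[int]_h) (sigma : 'M[C]_h) :
  A^T *m A' = 1%:M -> B^T = B -> Siegel sigma ->
  Siegel_act (block_mx A (B *m A') 0 A') sigma =
  map_mx (@intC R) A *m sigma *m (map_mx (@intC R) A)^T + map_mx (@intC R) B.
Proof.
move=> AA' Bsym Ssigma; apply: Siegel_act_unique => //; first exact: Gamma_shear.
rewrite map_block_mx block_mxKul block_mxKur block_mxKdl block_mxKdr.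
rewrite map_mx0 mul0mx add0r map_mxM mulmxDl -(mulmxA (_ *m sigma)).
have -> : (map_mx (@intC R) A)^T *m map_mx (@intC R) A' = 1%:M.
  by rewrite map_trmx -map_mxM AA' map_mx1.
by rewrite mulmx1.
Qed.

Context (F : 'M[C]_k.+1 -> C) (FG : Gamma_invariant F).

Lemma Gamma_invariant_heisenberg (tau : 'M[C]_k) m n q t : tau^T = tau ->
  Siegel (bordered t tau) ->
  F (bordered (heisenberg_act tau m n q t) tau) = F (bordered t tau).
Proof.
move=> tausym St.
(* The Heisenberg map is sigma |-> A sigma A^T + B: [A] adds m times the lower rows and columns to
   the first ones, and [B] supplies n, q and the corner term n m^T. [A'] is the inverse transpose of
   [A]. *)
pose A : 'M[int]_(1 + k) := block_mx 1%:M m 0 1%:M.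
pose A' : 'M[int]_(1 + k) := block_mx 1%:M 0 (- m^T) 1%:M.
pose B : 'M[int]_(1 + k) := block_mx (q%:M + n *m m^T) n n^T 0.
have AA' : A^T *m A' = 1%:M.
  rewrite tr_block_mx mulmx_block !trmx0 !trmx1 !mulmx0 !mul0mx !mul1mx !mulmx1.
  by rewrite !addr0 add0r subrr -scalar_mx_block.
have Bsym : B^T = B by rewrite tr_block_mx trmx0 trmxK mx11_tr.
rewrite -(FG (Gamma_shear AA' Bsym) St); congr F.
have -> := Siegel_act_shear AA' Bsym St.
rewrite /bordered/= !map_block_mx tr_block_mx !mulmx_block !map_mx1 !map_mx0.
rewrite !trmx0 !trmx1 !mulmx0 !mul0mx !mul1mx !mulmx1 !add0r.
rewrite add_block_mx addr0. apply: (@congr_block_mx C 1 k 1 k) => //.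
- rewrite [LHS](_ : _ = t.1%:M + map_mx (@intC R) m *m tau *m (map_mx (@intC R) m)^T +
    (map_mx (@intC R) m *m t.2^T + map_mx (@intC R) m *m t.2^T) +
    map_mx (@intC R) n *m (map_mx (@intC R) m)^T + (intC R q)%:M); last first.
    apply/matrixP => i j; rewrite !ord1 mxE eqxx mulr1n.
    have addE (X Y : 'M[C]_1) : (X + Y) 0 0 = X 0 0 + Y 0 0 by rewrite mxE.
    have scE x : (x%:M : 'M[C]_1) 0 0 = x by rewrite mxE eqxx mulr1n.
    by rewrite !addE !scE mulr2n mulrDl !mul1r.
  have -> : map_mx (@intC R) m *m t.2^T + map_mx (@intC R) m *m t.2^T =
    map_mx (@intC R) m *m t.2^T + t.2 *m (map_mx (@intC R) m)^T.
    by congr (_ + _); rewrite -[LHS]mx11_tr trmx_mul trmxK.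
  rewrite map_mxD map_scalar_mx map_mxM -map_trmx mulmxDl.
  by rewrite [RHS](AC (2*2*2) (1*4*(2*3)*6*5)).
- by rewrite !linearD/= trmx_mul tausym map_trmx.
Qed.

Lemma Gamma_invariant_sign (tau : 'M[C]_k) t : tau^T = tau ->
  Siegel (bordered t tau) ->
  F (bordered (t.1, - t.2) tau) = F (bordered t tau).
Proof.
move=> tausym St.
pose A : 'M[int]_(1 + k) := block_mx 1%:M 0 0 (- 1%:M).
have AA : A^T *m A = 1%:M.
  rewrite tr_block_mx linearN/= mulmx_block !trmx0 !trmx1 !mulmx0 !mul0mx !mulmx1.
  by rewrite mulNmx mul1mx opprK !addr0 add0r -scalar_mx_block.
rewrite -(FG (Gamma_shear AA (trmx0 _ _ _)) St); congr F.
have -> := Siegel_act_shear AA (trmx0 _ _ _) St.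
rewrite map_mx0 addr0 /bordered/= !map_block_mx tr_block_mx !mulmx_block.
rewrite map_mxN !map_mx1 !map_mx0.
rewrite !trmx0 linearN/= !trmx1.
rewrite !(mulmx0, mul0mx, mulNmx, mulmxN, mul1mx, mulmx1, opprK, addr0, add0r).
apply: (@congr_block_mx C 1 k 1 k) => //;
  by rewrite [(- 1%:M)^T]linearN /= trmx1 mulmxN mulmx1 ?opprK.
Qed.

(** This is the equation of the action with the denominator cleared, from which [Siegel_act_unique]
    reads off the image. Here [s] stands for kap + i v, and (la, mu) = (la', mu') M in blocks. *)
Lemma Siegel_act_embed_block (a b c d tau tau' : 'M[C]_k) (la' mu' : 'rV[C]_k)
    (s : C) (la := la' *m a + mu' *m c) (mu := la' *m b + mu' *m d)
    (t2 := la *m tau + mu) (t2' := la' *m tau' + mu') :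
  a^T *m c = c^T *m a -> a^T *m d - c^T *m b = 1%:M ->
  tau^T = tau -> tau'^T = tau' -> tau' *m (c *m tau + d) = a *m tau + b ->
  block_mx ((s + (la' *m t2'^T) 0 0)%:M : 'M[C]_1) t2' t2'^T tau' *m
    (block_mx 0 0 0 c *m block_mx ((s + (la *m t2^T) 0 0)%:M : 'M[C]_1) t2 t2^T tau +
     block_mx 1%:M 0 0 d) =
  block_mx 1%:M 0 0 a *m
    block_mx ((s + (la *m t2^T) 0 0)%:M : 'M[C]_1) t2 t2^T tau +
  block_mx 0 0 0 b.
Proof.
move=> e1 e3 tausym tau'sym tau'q.
have t2E : t2 = t2' *m (c *m tau + d).
  rewrite [RHS]mulmxDl -[la' *m tau' *m _]mulmxA tau'q.
  rewrite /t2 /la /mu mulmxDl !mulmxDr !mulmxA.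
  by rewrite addrACA.
(* a - tau' c is the inverse transpose of c tau + d. Together with [t2E] it gives the entries in the
   column t2^T, and from them the corner. *)
have qac : (a - tau' *m c) *m (c *m tau + d)^T = 1%:M.
  apply: mulmx1C; rewrite mulmxBr mulmxA -{1}tau'sym -trmx_mul tau'q.
  rewrite !linearD/= !trmx_mul tausym !mulmxDl -!mulmxA e1 opprD addrACA subrr add0r.
  by rewrite -[RHS]trmx1 -e3 linearB/= !trmx_mul !trmxK.
have act2 : a *m t2^T = t2'^T + tau' *m (c *m t2^T).
  by apply/eqP; rewrite mulmxA -subr_eq -mulmxBl t2E trmx_mul mulmxA qac mul1mx.
have laE : la *m t2^T = la' *m t2'^T + t2' *m (c *m t2^T).
  rewrite [LHS]mulmxDl -[la' *m a *m _]mulmxA act2 mulmxDr mulmxA -addrA.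
  by rewrite -[mu' *m c *m _]mulmxA -mulmxDl.
rewrite !(mulmx_block, mul0mx, mulmx0, mul1mx, mulmx1, add_block_mx, addr0, add0r).
apply: (@congr_block_mx C 1 k 1 k) => //; rewrite laE.
move: (la' *m t2'^T) (t2' *m (c *m t2^T)) => x y.
by rewrite [y in LHS]mx11_scalar -raddfD/= [in RHS]mxE addrA.
Qed.

Lemma Siegel_act_embed (M : 'M[int]_(k + k)) v (tau : 'M[C]_k) kap z :
  Gamma M -> 0 < v -> Siegel tau ->
  @Siegel_act R (1 + k) (Gamma_embed M)
    (bordered (heisenberg_point v tau kap (z *m intR M)) tau) =
  bordered (heisenberg_point v (Siegel_act M tau) kap z) (Siegel_act M tau).
Proof.
move=> GM v0 Stau.
have St := Siegel_bordered kap (z *m intR M) v0 Stau.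
have [tau'sym _] := Siegel_Siegel_act GM Stau; have [tausym _] := Stau.
have := Siegel_actK GM Stau; move: (Siegel_act M tau) tau'sym => tau' tau'sym.
rewrite -map_ulsubmx -map_ursubmx -map_dlsubmx -map_drsubmx => tau'q.
have [e1 _ e3] : [/\ (ulsubmx M)^T *m dlsubmx M = (dlsubmx M)^T *m ulsubmx M,
    (ursubmx M)^T *m drsubmx M = (drsubmx M)^T *m ursubmx M &
    (ulsubmx M)^T *m drsubmx M - (dlsubmx M)^T *m ursubmx M = 1%:M].
  by apply/Gamma_block; rewrite submxK.
have laE : real_mx (lsubmx (z *m intR M)) =
    real_mx (lsubmx z) *m map_mx (@intC R) (ulsubmx M) +
    real_mx (rsubmx z) *m map_mx (@intC R) (dlsubmx M).
  rewrite -{1}[z]hsubmxK -{1}[M]submxK map_block_mx mul_row_block row_mxKl.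
  by rewrite !intC_real_mx /real_mx map_mxD !map_mxM.
have muE : real_mx (rsubmx (z *m intR M)) =
    real_mx (lsubmx z) *m map_mx (@intC R) (ursubmx M) +
    real_mx (rsubmx z) *m map_mx (@intC R) (drsubmx M).
  rewrite -{1}[z]hsubmxK -{1}[M]submxK map_block_mx mul_row_block row_mxKr.
  by rewrite !intC_real_mx /real_mx map_mxD !map_mxM.
apply: (@Siegel_act_unique R (1 + k) (Gamma_embed M));
  [exact: Gamma_Gamma_embed|exact: St|].
rewrite /Gamma_embed map_block_mx block_mxKul block_mxKur block_mxKdl block_mxKdr.
rewrite !map_block_mx !map_mx0 !map_mx1 /bordered /heisenberg_point laE muE /=.
apply: Siegel_act_embed_block => //.
- by rewrite !map_trmx -!map_mxM e1.
- by rewrite !map_trmx -!map_mxM -map_mxB e3 map_mx1.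
Qed.

Lemma Gamma_invariant_point (M : 'M[int]_(k + k)) v (tau : 'M[C]_k) kap z :
  Gamma M -> 0 < v -> Siegel tau ->
  F (bordered (heisenberg_point v (Siegel_act M tau) kap z) (Siegel_act M tau)) =
  F (bordered (heisenberg_point v tau kap (z *m intR M)) tau).
Proof.
move=> GM v0 Stau; rewrite -(Siegel_act_embed _ _ GM)//.
by apply: FG; [exact: (Gamma_Gamma_embed GM)|exact: Siegel_bordered].
Qed.

End Invariance.

(** * The Heisenberg group as a countable measure-preserving group on R^(1+2k) *)

Section HeisenbergSpace.
Context (R : realType).

Definition heisenberg_space n : Type :=
  (measurableTypeR R * n.-tuple (measurableTypeR R))%type.

HB.instance Definition _ n := Measurable.on (heisenberg_space n).

Definition heisenberg_measure n : set (heisenberg_space n) -> \bar R :=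
  product_measure1 (@lebesgue_measure R) (lebesgue_tuple n).

HB.instance Definition _ n := Measure.on (@heisenberg_measure n).

(** One family covers the Heisenberg translations, the symplectic maps and the chart: an affine map
    of (la, mu) together with a shear of kap, with [f] a polynomial of degree at most 2. *)
Definition skew_affine n (f : 'rV[R]_n -> R) (A : 'M[R]_n) (c : 'rV[R]_n)
    (p : heisenberg_space n) : heisenberg_space n :=
  (p.1 + f (row_of_tuple p.2), affine_tuple A c p.2).

Definition quadratic n (Q : 'M[R]_n) (l : 'rV[R]_n) (q : R) (z : 'rV[R]_n) :=
  (z *m Q *m z^T) 0 0 + (z *m l^T) 0 0 + q.

Lemma measurable_quadratic n (Q : 'M[R]_n) (l : 'rV[R]_n) (q : R) :
  measurable_fun setT (fun t : n.-tuple (measurableTypeR R) =>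
    quadratic Q l q (row_of_tuple t) : measurableTypeR R).
Proof.
have mrow := measurable_row_of_tuple (@measurable_id _ (n.-tuple (measurableTypeR R)) setT).
have mQ : measurable_row (fun t : n.-tuple (measurableTypeR R) => row_of_tuple t *m Q).
  by apply: (measurable_rowM mrow) => i; exact: measurable_row_cst.
have mT i : measurable_row (fun t : n.-tuple (measurableTypeR R) =>
    row i (row_of_tuple t)^T).
  by move=> j; apply: (eq_measurable_fun _ _ (mrow i)) => t _; rewrite !mxE.
have ml : measurable_row (fun t : n.-tuple (measurableTypeR R) => row_of_tuple t *m l^T).
  by apply: (measurable_rowM mrow) => i; exact: measurable_row_cst.
have mzQz := measurable_rowM mQ mT.
by apply: measurable_funD; [exact: measurable_funD (mzQz 0) (ml 0)|exact: measurable_cst].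
Qed.

Lemma scales_skew_affine n Q l q (A : 'M[R]_n) (c : 'rV[R]_n) :
  `|\det A| = 1 ->
  scales_measure 1 (@heisenberg_measure n) (@heisenberg_measure n)
    (skew_affine (quadratic Q l q) A c).
Proof.
move=> dA; have dA0 : \det A != 0 by rewrite -normr_eq0 dA oner_eq0.
have s1 : scales_measure 1 (@heisenberg_measure n) (@heisenberg_measure n)
    (fun p => (1 * p.1 + quadratic Q l q (row_of_tuple p.2), p.2)).
  apply: (@scales_skew_fst R _ _ _ _ _ _ 1 (@lebesgue_measure R)
    (@lebesgue_measure R) (@lebesgue_tuple R n)
    (fun t x => 1 * x + quadratic Q l q (row_of_tuple t))) => //.
    apply: measurable_funD; first exact: measurable_funM.
    apply: (measurableT_comp (measurable_quadratic Q l q)).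
    exact: measurable_snd.
  move=> t; have := @scales_lebesgue_affine R 1 (quadratic Q l q (row_of_tuple t)).
  by rewrite normr1 invr1; apply; exact: oner_neq0.
have s2 : scales_measure 1 (@heisenberg_measure n) (@heisenberg_measure n)
    (fun p => (p.1, affine_tuple A c p.2)).
  apply: (@scales_skew_snd R _ _ _ _ _ _ 1 (@lebesgue_measure R)
    (@lebesgue_tuple R n) (@lebesgue_tuple R n) (fun _ t => affine_tuple A c t)) => //.
    apply: measurable_affine_tuple; first exact: measurable_snd.
    exact: measurable_row_cst.
  by move=> _; have := scales_affine_tuple c dA0; rewrite dA invr1.
have := scales_comp s1 s2; rewrite mulr1; congr scales_measure.
by apply/funext => p; rewrite /skew_affine /= mul1r.
Qed.

End HeisenbergSpace.

Section Omega.

(** The standard symplectic form on rows; it is the cocycle in the composition law of the Heisenberg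
    translations. *)
Definition omega (R : comPzRingType) k (x z : 'rV[R]_(k + k)) : R :=
  (x *m block_mx 0 1%:M (- 1%:M) 0 *m z^T) 0 0.

Lemma omegaE (R : comPzRingType) k (x z : 'rV[R]_(k + k)) :
  omega x z = (lsubmx x *m (rsubmx z)^T - lsubmx z *m (rsubmx x)^T) 0 0.
Proof.
rewrite /omega -[in LHS](hsubmxK x) -[in LHS](hsubmxK z) tr_row_mx.
rewrite mul_row_block mul_row_col !mulmx0 !mulmx1 add0r addr0 mulmxN mulmx1 mulNmx.
rewrite [LHS]mxE [RHS]mxE addrC; congr (_ + _).
by rewrite mxE [RHS]mxE dot_rowC.
Qed.

Lemma omegaDl (R : comPzRingType) k (x y z : 'rV[R]_(k + k)) :
  omega (x + y) z = omega x z + omega y z.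
Proof. by rewrite /omega !mulmxDl mxE. Qed.

Lemma omegaDr (R : comPzRingType) k (x y z : 'rV[R]_(k + k)) :
  omega z (x + y) = omega z x + omega z y.
Proof. by rewrite /omega linearD/= mulmxDr mxE. Qed.

Lemma omegaZl (R : comPzRingType) k a (x z : 'rV[R]_(k + k)) :
  omega (a *: x) z = a * omega x z.
Proof. by rewrite /omega -!scalemxAl mxE. Qed.

Lemma omegaZr (R : comPzRingType) k a (x z : 'rV[R]_(k + k)) :
  omega z (a *: x) = a * omega z x.
Proof. by rewrite /omega linearZ/= -!scalemxAr mxE. Qed.

Lemma omega0l (R : comPzRingType) k (x : 'rV[R]_(k + k)) : omega 0 x = 0.
Proof. by rewrite /omega !mul0mx mxE. Qed.

Lemma omegaxx (R : comPzRingType) k (x : 'rV[R]_(k + k)) : omega x x = 0.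
Proof. by rewrite omegaE subrr mxE. Qed.

Lemma omega_map (R S : comPzRingType) (f : {rmorphism R -> S}) k
    (x z : 'rV[R]_(k + k)) :
  omega (map_mx f x) (map_mx f z) = f (omega x z).
Proof.
transitivity (map_mx f (x *m block_mx 0 1%:M (- 1%:M) 0 *m z^T) 0 0).
  by rewrite !map_mxM -map_trmx map_block_mx map_mxN !map_mx0 !map_mx1.
by rewrite mxE.
Qed.

Lemma omega_Gamma (R : realType) k (M : 'M[int]_(k + k)) (x z : 'rV[R]_(k + k))
    (N := map_mx (intmul 1) M) : Gamma M ->
  omega (x *m N) (z *m N) = omega x z.
Proof.
move=> /Gamma_tr/(congr1 (map_mx (intmul (1 : R)))).
rewrite !map_mxM -map_trmx map_block_mx map_mxN !map_mx0 !map_mx1 => MJ.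
by rewrite /omega trmx_mul -!mulmxA -[in RHS]MJ !mulmxA.
Qed.

End Omega.

Section HeisenbergGroup.
Context (R : realType) (k : nat).
Local Notation intR := (map_mx (intmul (1 : R))).
Local Notation H := (heisenberg_space R (k + k)).

(* (s, x, q) encodes the sign (-1)^s followed by the translation by (x, q). *)
Definition heisenberg_code := (bool * 'rV[int]_(k + k) * int)%type.

Definition heisenberg_map (e : heisenberg_code) : H -> H :=
  let: (s, x, q) := e in
  skew_affine
    (quadratic 0 ((-1) ^+ s *: (intR x *m block_mx 0 1%:M (- 1%:M) 0)) q%:~R)
    ((-1) ^+ s)%:M (intR x).

Arguments heisenberg_map : simpl never.

Lemma heisenberg_mapE s x q (p : H) :
  heisenberg_map (s, x, q) p =
  (p.1 + (q%:~R + omega (intR x) ((-1) ^+ s *: row_of_tuple p.2)),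
   tuple_of_row ((-1) ^+ s *: row_of_tuple p.2 + intR x)).
Proof.
rewrite /heisenberg_map /skew_affine /affine_tuple mul_mx_scalar; congr pair.
congr (_ + _); rewrite /quadratic mulmx0 mul0mx mxE add0r addrC.
by rewrite omegaZr dot_rowC -scalemxAl [X in _ + X]mxE.
Qed.

Lemma scales_heisenberg_map e :
  scales_measure 1 (@heisenberg_measure R (k + k)) (@heisenberg_measure R (k + k))
    (heisenberg_map e).
Proof.
case: e => -[s x] q; apply: scales_skew_affine.
by rewrite det_scalar normrX normrX normrN1 !expr1n.
Qed.

Lemma heisenberg_map_comp e1 e2 : exists e3,
  heisenberg_map e3 =1 heisenberg_map e1 \o heisenberg_map e2.
Proof.
case: e1 e2 => -[s1 x1] q1 [[s2 x2] q2].
(* The sign [s1] acts on [x2] and fixes the central part, and the last component picks up the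
   cocycle at [x1] and the signed [x2]. *)
exists (s1 (+) s2, (-1) ^+ s1 *: x2 + x1,
  q1 + q2 + (-1) ^+ s1 * omega x1 x2) => p.
rewrite /= !heisenberg_mapE /= tuple_of_rowK.
have -> : intR ((-1) ^+ s1 *: x2 + x1) = (-1) ^+ s1 *: intR x2 + intR x1.
  by rewrite map_mxD map_mxZ rmorph_sign.
rewrite signr_addb; congr pair; last by rewrite scalerDr scalerA addrA.
rewrite -[RHS]addrA; congr (_ + _).
rewrite scalerDr !(omegaDl, omegaDr, omegaZl, omegaZr) omega_map.
rewrite !rmorphD rmorphM rmorph_sign /= !mulrA -expr2 sqrr_sign mul1r.
by ring.
Qed.

(** The last component needs no correction by [omega], since omega(x, x) = 0. *)
Definition heisenberg_code_inv (e : heisenberg_code) : heisenberg_code :=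
  let: (s, x, q) := e in (s, - ((-1) ^+ s *: x), - q).

Lemma heisenberg_mapK e :
  cancel (heisenberg_map e) (heisenberg_map (heisenberg_code_inv e)).
Proof.
case: e => -[s x] q [kap t].
rewrite /= !heisenberg_mapE /= tuple_of_rowK.
have -> : intR (- ((-1) ^+ s *: x)) = - ((-1) ^+ s *: intR x).
  by rewrite map_mxN map_mxZ rmorph_sign.
rewrite scalerDr scalerA -expr2 sqrr_sign scale1r addrK row_of_tupleK.
rewrite -[- (_ *: _)]scaleN1r !(omegaDr, omegaZl, omegaZr) omegaxx !mulr0 addr0 rmorphN /=.
by congr pair; ring.
Qed.

Lemma heisenberg_code_invK : involutive heisenberg_code_inv.
Proof.
by case=> -[s x] q; rewrite /= scalerN scalerA -expr2 sqrr_sign scale1r !opprK.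
Qed.

(** Codes form a countable type; numbers that encode nothing are sent to (false, 0, 0), the
    identity. *)
Definition heisenberg_enum (n : nat) : H -> H :=
  heisenberg_map (odflt (false, 0, 0) (unpickle n)).

Lemma heisenberg_enum_code e : exists n, heisenberg_enum n = heisenberg_map e.
Proof. by exists (pickle e); rewrite /heisenberg_enum pickleK. Qed.

Lemma heisenberg_group :
  measure_preserving_group (@heisenberg_measure R (k + k)) heisenberg_enum.
Proof.
split=> [j|i j|j]; first exact: scales_heisenberg_map.
  rewrite /heisenberg_enum.
  have [e eE] := heisenberg_map_comp (odflt (false, 0, 0) (unpickle i))
    (odflt (false, 0, 0) (unpickle j)).
  by have [n nE] := heisenberg_enum_code e; exists n => p; rewrite -eE -nE.
have [n nE] := heisenberg_enum_code
  (heisenberg_code_inv (odflt (false, 0, 0) (unpickle j))).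
exists n; rewrite nE /heisenberg_enum; move: (odflt _ _) => e {n nE}.
split; first exact: heisenberg_mapK.
by have := heisenberg_mapK (heisenberg_code_inv e); rewrite heisenberg_code_invK.
Qed.

End HeisenbergGroup.
Arguments heisenberg_map : simpl never.

(** * From Heisenberg coordinates to unipotent coordinates and their fundamental domains *)

Section Charts.
Context (R : realType) (k : nat).
Local Notation C := R[i].
Local Notation intR := (map_mx (intmul (1 : R))).
Local Notation H := (heisenberg_space R (k + k)).

Definition hpoint (v : R) (tau : 'M[C]_k) (p : H) : C * 'rV[C]_k :=
  heisenberg_point v tau p.1 (row_of_tuple p.2).

Lemma heisenberg_act_hpoint v (tau : 'M[C]_k) m n q p : tau^T = tau ->
  heisenberg_act tau m n q (hpoint v tau p) =
  hpoint v tau (heisenberg_map (false, row_mx m n, q) p).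
Proof.
move=> tausym; rewrite /hpoint heisenberg_act_point// heisenberg_mapE /=.
rewrite tuple_of_rowK scale1r omegaE map_row_mx row_mxKl row_mxKr.
by rewrite -addrA.
Qed.

Lemma sign_hpoint v (tau : 'M[C]_k) p :
  ((hpoint v tau p).1, - (hpoint v tau p).2) =
  hpoint v tau (heisenberg_map (true, 0, 0) p).
Proof.
rewrite /hpoint heisenberg_mapE /= tuple_of_rowK map_mx0 addr0 scaleN1r.
by rewrite neg_heisenberg_point omega0l !addr0.
Qed.

Lemma heisenberg_map_id : @heisenberg_map R k (false, 0, 0) = id.
Proof.
apply/funext => -[kap t]; rewrite heisenberg_mapE /= map_mx0 addr0 scale1r.
by rewrite row_of_tupleK omega0l !addr0.
Qed.

Lemma heisenberg_map_sign s x q : @heisenberg_map R k (s, x, q) =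
  heisenberg_map (false, x, q) \o heisenberg_map (s, 0, 0).
Proof.
apply/funext => p; rewrite /= !heisenberg_mapE /= tuple_of_rowK map_mx0 addr0.
by rewrite scale1r omega0l !addr0.
Qed.

(** With the converse [hpoint_parabolic], this identifies the parabolic group at tau with one group
    of Heisenberg maps that no longer mentions tau. *)
Lemma parabolic_hpoint v (tau : 'M[C]_k) p : tau^T = tau -> parabolic tau p ->
  exists e, forall x, p (hpoint v tau x) = hpoint v tau (heisenberg_map e x).
Proof.
move=> tausym; elim=> [|m n q||p1 p2 _ [e1 e1P] _ [e2 e2P]].
- by exists (false, 0, 0) => x; rewrite heisenberg_map_id.
- by exists (false, row_mx m n, q) => x; exact: heisenberg_act_hpoint.
- by exists (true, 0, 0) => x; exact: sign_hpoint.
- have [e eP] := heisenberg_map_comp R e1 e2.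
  by exists e => x; rewrite eP /= e2P e1P.
Qed.

Lemma hpoint_parabolic v (tau : 'M[C]_k) e : tau^T = tau ->
  exists2 p, parabolic tau p &
    forall x, p (hpoint v tau x) = hpoint v tau (heisenberg_map e x).
Proof.
move=> tausym; case: e => -[s x] q.
have [p ptau pE] : exists2 p, parabolic tau p &
    forall x, p (hpoint v tau x) = hpoint v tau (heisenberg_map (s, 0, 0) x).
  case: s.
    by exists (fun t => (t.1, - t.2)) => [|y]; [exact: parabolic_sign|exact: sign_hpoint].
  by exists id => [|y]; [exact: parabolic_id|rewrite heisenberg_map_id].
exists (heisenberg_act tau (lsubmx x) (rsubmx x) q \o p).
  by apply: parabolic_comp => //; exact: parabolic_heisenberg.
by move=> y; rewrite /= pE heisenberg_act_hpoint// hsubmxK [in RHS]heisenberg_map_sign.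
Qed.

Lemma hpoint_inj v (tau : 'M[C]_k) : Siegel tau -> injective (hpoint v tau).
Proof.
move=> /SiegelP[X [Y [-> _ Ypos]]] [kap t] [kap' t'] E.
have tt' : t = t'.
  have := congr1 snd E; rewrite /hpoint /heisenberg_point /=.
  rewrite !mul_real_complex_mx ![real_mx (rsubmx _)]real_mxE !add_complex_mx !addr0.
  move=> /complex_mx_inj[+ /(congr1 (mulmx^~ (invmx Y)))].
  rewrite /= !mulmxK ?posdef_unitmx// => + E4; rewrite E4 => /addrI E3.
  by rewrite -[t]row_of_tupleK -[row_of_tuple t]hsubmxK E4 E3 hsubmxK row_of_tupleK.
have := congr1 fst E; rewrite tt' /hpoint /heisenberg_point /=.
by move=> /addIr[->].
Qed.

Lemma border_inj v (tau : 'M[C]_k) : Siegel tau -> injective (border v tau).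
Proof.
move=> Stau [[w11 w] u] [[w11' w'] u']; have := IwasawaP Stau; rewrite /border.
case: (Iwasawa tau) => -[W U] vs [_ Utri vs0 _] [ew11 _].
move=> /complex_mx_inj[ew eu].
have UU : U \in unitmx by rewrite unitmxE det_unitriangular// unitr1.
have VU : sqrt_diag vs ^+ 2 *m U^T \in unitmx.
  rewrite unitmx_mul unitmx_tr UU andbT sqrt_diag_sqr// unitmxE det_diag unitfE.
  by apply/prodf_neq0 => i _; exact: lt0r_neq0.
move: eu VU; rewrite -!mulmxA; move: (_ *m U^T) => B eu BU.
have /(can_inj (@row_of_tupleK R k)) -> := can_inj (mulmxK BU) eu.
by move: ew => /(can_inj (@row_of_tupleK R k)) ->; rewrite ew11.
Qed.

(* From (kap, la, mu) to ((w_ii, w), u) = ((kap + la W la^T + la mu^T,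
   la W + mu), la U). *)
Definition heisenberg_chart (tau : 'M[C]_k) (p : H) : unip R k :=
  let: (W, U, _) := Iwasawa tau in
  let p' := skew_affine (quadratic (block_mx W 1%:M 0 0) 0 0)
    (block_mx W U 1%:M 0) 0 p in
  ((p'.1, (tuple_split p'.2).1), (tuple_split p'.2).2).

Lemma scales_heisenberg_chart (tau : 'M[C]_k) : Siegel tau ->
  scales_measure 1 (@heisenberg_measure R (k + k)) (@unip_measure R k)
    (heisenberg_chart tau).
Proof.
move=> /IwasawaP; rewrite /heisenberg_chart.
case: (Iwasawa tau) => -[W U] vs [_ Utri _ _].
have dA : `|\det (block_mx W U 1%:M 0)| = 1.
  (* Up to the exchange of the two halves, whose square is 1, the matrix is block triangular with U
     and 1 on the diagonal. *)
  have -> : block_mx W U 1%:M 0 =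
      block_mx U W 0 1%:M *m block_mx 0 1%:M 1%:M 0.
    by rewrite mulmx_block !mulmx0 !mul0mx !mulmx1 !addr0 !add0r.
  rewrite det_mulmx det_ublock det_unitriangular// det1 !mul1r.
  apply/eqP; rewrite -sqr_norm_eq1 expr2 -det_mulmx mulmx_block.
  by rewrite !mulmx0 !mul0mx !mulmx1 !addr0 !add0r -scalar_mx_block det1.
have s1 := scales_skew_affine (block_mx W 1%:M 0 0) 0 0 0 dA.
have s2 : scales_measure 1 (@heisenberg_measure R (k + k))
    (product_measure1 (@lebesgue_measure R)
      (product_measure1 (@lebesgue_tuple R k) (@lebesgue_tuple R k)))
    (fun p => (p.1, tuple_split p.2)).
  have [msplit splitE] := scales_tuple_split R k k.
  split=> [|A mA].
    apply: measurable_fun_pair; first exact: measurable_fst.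
    by apply: measurableT_comp; [exact: msplit|exact: measurable_snd].
  rewrite mul1e; apply: eq_integral => x _ /=.
  rewrite -[RHS]mul1e -splitE; last exact: measurable_xsection.
  by congr (lebesgue_tuple _ _); apply/seteqP; split=> z; rewrite /xsection/= !inE.
have s3 := scales_assoc' (@lebesgue_measure R) (@lebesgue_tuple R k)
  (@lebesgue_tuple R k).
by have := scales_comp (scales_comp s1 s2) s3; rewrite !mulr1.
Qed.

(** With Y = U V^2 U^T, the choice u = la U gives u V^2 U^T = la Y and u V^2 u^T = la Y la^T, the
    imaginary parts of tau_2 and of la tau_2^T. *)
Lemma border_heisenberg_chart v (tau : 'M[C]_k) p : Siegel tau ->
  border v tau (heisenberg_chart tau p) = hpoint v tau p.
Proof.
move=> Stau; have := IwasawaP Stau; rewrite /heisenberg_chart /border.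
case: (Iwasawa tau) => -[W U] vs [Wsym _ _ tauE].
case: p => kap t; rewrite /skew_affine /affine_tuple /tuple_split /=.
rewrite !tuple_of_rowK /hpoint /heisenberg_point /= tauE.
have := Stau.1; rewrite tauE tr_complex_mx => /complex_mx_inj[_].
set V := sqrt_diag vs ^+ 2; set Y := U *m V *m U^T => Ysym.
set la := lsubmx (row_of_tuple t); set mu := rsubmx (row_of_tuple t).
have -> : row_of_tuple t = row_mx la mu by rewrite hsubmxK.
move: la mu => la mu.
rewrite !addr0 mul_row_block !mulmx1 mulmx0 addr0 row_mxKl row_mxKr.
rewrite real_mxE (real_mxE mu) mul_complex_mx !mul0mx subr0 addr0.
rewrite add_complex_mx addr0 tr_complex_mx mul_complex_mx !mul0mx subr0 addr0.
rewrite [(la *m Y)^T]trmx_mul Ysym.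
have -> : quadratic (block_mx W 1%:M 0 0) 0 0 (row_mx la mu) =
    (la *m (la *m W + mu)^T) 0 0.
  rewrite /quadratic trmx0 mulmx0 [X in _ + X + _]mxE !addr0.
  rewrite mul_row_block !mulmx0 !addr0 mulmx1 tr_row_mx mul_row_col.
  by rewrite linearD/= trmx_mul Wsym mulmxDr mulmxA.
congr pair; last by rewrite /Y !mulmxA.
rewrite [complex_mx _ _ _ _]mxE; apply/eqP; rewrite eq_complex /= eqxx /=.
by rewrite /Y trmx_mul !mulmxA.
Qed.

(* s is a change of Heisenberg coordinates normalizing the Heisenberg group: the
   identity at tau, the action of an element of Gamma_k at its translate. *)
Lemma fundamental_domain_chart v (tau : 'M[C]_k) (b : H -> unip R k)
    (s : H -> H) D :
  scales_measure 1 (@heisenberg_measure R (k + k)) (@unip_measure R k) b ->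
  Siegel tau -> injective s ->
  (forall x, border v tau (b x) = hpoint v tau (s x)) ->
  (forall e, exists e', forall x, s (heisenberg_map e' x) = heisenberg_map e (s x)) ->
  (forall e, exists e', forall x, s (heisenberg_map e x) = heisenberg_map e' (s x)) ->
  fundamental_domain v tau D ->
  fundamental_set (@heisenberg_measure R (k + k)) (@heisenberg_enum R k)
    (b @^-1` D).
Proof.
move=> sb Stau sinj bE se es [mD Dcov Dnull]; have [tausym _] := Stau.
split.
- exact: (scales_measurable sb).
- apply: (negligibleS _ (negligible_scales sb Dcov)) => x /=.
  apply: contra_not => -[p [ptau [y Dy yE]]].
  have [e pE] := parabolic_hpoint v tausym ptau.
  have [e' se'] := se e; have [n nE] := heisenberg_enum_code R e'.
  exists n; rewrite nE (_ : b _ = y)//; apply: (border_inj Stau (v := v)).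
  by rewrite yE bE se' -pE -bE.
move=> j [x0 jx0].
have [e' es'] := es (odflt (false, 0, 0) (unpickle j)).
have [p ptau pE] := hpoint_parabolic v e' tausym.
have pb x : p (border v tau (b x)) = border v tau (b (heisenberg_enum j x)).
  by rewrite !bE pE es'.
apply: (negligibleS _ (negligible_scales sb (Dnull _ ptau _))).
  by move=> x [Dx Djx]; split=> //; exists (b (heisenberg_enum j x)).
(* A group element that moves [x0] yields a parabolic map that moves a point, because [hpoint] and
   [s] are injective. *)
exists (border v tau (b x0)); rewrite pb !bE => /(hpoint_inj Stau)/sinj.
exact: jx0.
Qed.

End Charts.

(** * Invariance of the averages *)

Section OneStep.
Context (R : realType) (k : nat).
Local Notation C := R[i].
Local Notation intR := (map_mx (intmul (1 : R))).
Local Notation H := (heisenberg_space R (k + k)).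

Definition symplectic_map (N : 'M[int]_(k + k)) : H -> H :=
  skew_affine (quadratic 0 0 0) (intR N) 0.

Lemma symplectic_mapE N p :
  symplectic_map N p = (p.1, tuple_of_row (row_of_tuple p.2 *m intR N)).
Proof.
rewrite /symplectic_map /skew_affine /affine_tuple addr0 /quadratic mulmx0 mul0mx.
by rewrite trmx0 mulmx0 !mxE !addr0.
Qed.

Lemma scales_symplectic_map N : Gamma N ->
  scales_measure 1 (@heisenberg_measure R (k + k)) (@heisenberg_measure R (k + k))
    (symplectic_map N).
Proof.
move=> /det_Gamma dN; apply: scales_skew_affine; rewrite det_map_mx.
by apply/eqP; rewrite -sqr_norm_eq1 -rmorphXn /= dN.
Qed.

(** Since N preserves [omega], the shift of kap is unchanged and conjugation only replaces x by x
    N. *)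
Lemma symplectic_map_heisenberg N s x q p : Gamma N ->
  symplectic_map N (heisenberg_map (s, x, q) p) =
  heisenberg_map (s, x *m N, q) (symplectic_map N p).
Proof.
move=> GN; rewrite !symplectic_mapE !heisenberg_mapE /= !tuple_of_rowK.
rewrite map_mxM mulmxDl -scalemxAl; congr (_ + (_ + _), _).
by rewrite scalemxAl (omega_Gamma _ _ GN).
Qed.

Lemma symplectic_mapK N N' : N *m N' = 1%:M -> cancel (symplectic_map N) (symplectic_map N').
Proof.
move=> NN' [kap t]; rewrite !symplectic_mapE /= tuple_of_rowK -mulmxA -map_mxM NN'.
by rewrite map_mx1 mulmx1 row_of_tupleK.
Qed.

Context (F : 'M[C]_k.+1 -> C) (FG : Gamma_invariant F).

Lemma Gamma_invariant_heisenberg_map v (tau : 'M[C]_k) e p :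
  0 < v -> Siegel tau ->
  F (bordered (hpoint v tau (heisenberg_map e p)) tau) =
  F (bordered (hpoint v tau p) tau).
Proof.
move=> v0 Stau; have tausym := Stau.1; case: e => -[s x] q.
have Sb p' : Siegel (bordered (hpoint v tau p') tau) by exact: Siegel_bordered.
rewrite heisenberg_map_sign /= -[x in heisenberg_map (_, x, _)]hsubmxK.
rewrite -heisenberg_act_hpoint// Gamma_invariant_heisenberg//.
case: s; last by rewrite heisenberg_map_id.
by rewrite -sign_hpoint Gamma_invariant_sign.
Qed.

Lemma Gamma_invariant_symplectic_map (M : 'M[int]_(k + k)) v (tau : 'M[C]_k) p :
  Gamma M -> 0 < v -> Siegel tau ->
  F (bordered (hpoint v (Siegel_act M tau) (symplectic_map (symplectic_inv M) p))
    (Siegel_act M tau)) =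
  F (bordered (hpoint v tau p) tau).
Proof.
move=> GM v0 Stau; rewrite /hpoint Gamma_invariant_point// symplectic_mapE /=.
rewrite tuple_of_rowK -mulmxA -map_mxM symplectic_invK//.
by rewrite map_mx1 mulmx1.
Qed.

(** [part] will be the real or the imaginary part. [G] is the integrand in Heisenberg coordinates at
    tau; the chart at M tau is preceded by the action of M^-1, so that both integrals become
    integrals of this same [G]. *)
Lemma eq_integral_border (M : 'M[int]_(k + k)) v (tau : 'M[C]_k) D1 D2
    (part : C -> R)
    (g := fun tau x => (part (F (bordered (border v tau x) tau)))%:E) :
  Gamma M -> 0 < v -> Siegel tau ->
  fundamental_domain v tau D1 -> fundamental_domain v (Siegel_act M tau) D2 ->
  measurable_fun D1 (g tau) -> measurable_fun D2 (g (Siegel_act M tau)) ->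
  (\int[@unip_measure R k]_(x in D2) g (Siegel_act M tau) x =
   \int[@unip_measure R k]_(x in D1) g tau x)%E.
Proof.
move=> GM v0 Stau fD1 fD2 mg1 mg2; set tau' := Siegel_act M tau.
have Stau' : Siegel tau' := Siegel_Siegel_act GM Stau.
have GN := Gamma_symplectic_inv GM; set N := symplectic_inv M in GN *.
pose G p := (part (F (bordered (hpoint v tau p) tau)))%:E.
have sb1 := scales_heisenberg_chart Stau.
have sb2 := scales_comp (scales_symplectic_map GN) (scales_heisenberg_chart Stau').
rewrite mulr1 in sb2.
have gb1 : g tau \o heisenberg_chart tau = G.
  by apply/funext => p; rewrite /g /= border_heisenberg_chart.
have gb2 : g tau' \o (heisenberg_chart tau' \o symplectic_map N) = G.
  apply/funext => p; rewrite /g /= border_heisenberg_chart//.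
  by rewrite Gamma_invariant_symplectic_map.
have [mD1 _ _] := fD1; have [mD2 _ _] := fD2.
rewrite -(integral_scales sb1 mD1 mg1) -(integral_scales sb2 mD2 mg2) gb1 gb2.
apply: (eq_integral_fundamental_set (heisenberg_group R k)).
- apply: (fundamental_domain_chart sb2 Stau' (s := symplectic_map N)) fD2.
  + exact: can_inj (symplectic_mapK (symplectic_invK GM)).
  + by move=> x; rewrite /= border_heisenberg_chart.
  + move=> [[s x] q]; exists (s, x *m M, q) => y.
    by rewrite symplectic_map_heisenberg// -mulmxA symplectic_invVK// mulmx1.
  + move=> [[s x] q]; exists (s, x *m N, q) => y.
    by rewrite symplectic_map_heisenberg.
- apply: (fundamental_domain_chart sb1 Stau (s := id)) fD1 => //.
  + by move=> x; rewrite border_heisenberg_chart.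
  + by move=> e; exists e.
  + by move=> e; exists e.
- by move=> j x; rewrite /G Gamma_invariant_heisenberg_map.
(* Measurability of [G] on a pulled-back domain is inherited from the integrand through the
   chart. *)
- rewrite -gb2; apply: (measurable_comp mD2) => //; last exact: measurable_funTS sb2.1.
  by move=> _ [x Dx <-].
- rewrite -gb1; apply: (measurable_comp mD1) => //; last exact: measurable_funTS sb1.1.
  by move=> _ [x Dx <-].
Qed.

End OneStep.

Section Iterate.
Context (R : realType).
Local Notation C := R[i].
Context (D : forall k, R -> 'M[C]_k -> set (unip R k)).
Arguments D {k} _ _.

(** Existence of the average supplies the measurability of both parts of the integrand on the
    domains at tau and at M tau. *)
Lemma average_Gamma_invariant k (F : 'M[C]_k.+1 -> C) v : 0 < v ->
  (forall tau : 'M[C]_k, Siegel tau -> fundamental_domain v tau (D v tau)) ->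
  (forall tau : 'M[C]_k, Siegel tau -> average_exists (@D) F v tau) ->
  Gamma_invariant F -> Gamma_invariant (average (@D) F v).
Proof.
move=> v0 fD Fex FG M tau GM Stau; have Stau' := Siegel_Siegel_act GM Stau.
have [/measurable_int mre /measurable_int mim] := Fex _ Stau.
have [/measurable_int mre' /measurable_int mim'] := Fex _ Stau'.
rewrite /average /Rintegral; congr (fine _ +i* fine _).
- exact: (eq_integral_border FG GM v0 Stau (fD _ Stau) (fD _ Stau') mre mre').
- exact: (eq_integral_border FG GM v0 Stau (fD _ Stau) (fD _ Stau') mim mim').
Qed.

(** Induction on r with g and f varying: one average is again an invariant function, one size lower,
    as the next step requires. *)
Lemma iter_average_Gamma_invariant r g (f : 'M[C]_g -> C) (v : r.-tuple R) :
  (forall k w (tau : 'M[C]_k), 0 < w -> Siegel tau ->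
    fundamental_domain w tau (D w tau)) ->
  (forall i, 0 < tnth v i) -> iter_average_exists (@D) f v ->
  Gamma_invariant f -> Gamma_invariant (iter_average (@D) f v).
Proof.
move=> fD; elim: r g f v => [|r IHr] [|g] f v v0 //= [fex rex] fG.
apply: IHr => //; last first.
  have v1 : 0 < thead v by exact: v0.
  by apply: average_Gamma_invariant => // tau; exact: fD.
move=> i; have := v0 (lift ord0 i).
by rewrite [v in tnth v]tuple_eta tnthS.
Qed.

End Iterate.

Theorem corollary1 (R : realType) (g r : nat) (hg : (2 <= g)%N)
    (hr : (1 <= r <= g - 1)%N)
    (f : 'M[R[i]]_g -> R[i]) (hf : Gamma_invariant f)
    (D : forall k : nat, R -> 'M[R[i]]_k -> set (unip R k))
    (hD : forall (k : nat) (v : R) (tau : 'M[R[i]]_k), 0 < v -> Siegel tau ->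
      fundamental_domain v tau (D k v tau))
    (v : r.-tuple R) (hv : forall i : 'I_r, 0 < tnth v i)
    (hex : iter_average_exists D f v)
    (M : 'M[int]_((g - r) + (g - r))) (hM : Gamma M)
    (tau : 'M[R[i]]_(g - r)) (htau : Siegel tau) :
  iter_average D f v (Siegel_act M tau) = iter_average D f v tau.
Proof. exact: (iter_average_Gamma_invariant hD hv hex hf). Qed.
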